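(* Let $\Psi=(\psi_1,\dots,\psi_d)$ with each $\psi_i:(0,\infty)\to(0,\infty)$ decreasing. Assume each $m_i$ is $\delta_i$-Ahlfors regular, the $\kappa$-scaling property holds for each $\{\mathcal R_{\alpha,i}\}_{\alpha\in J}$, and $(\{\mathcal R_\alpha\},\beta)$ is a uniform local ubiquity system for rectangles w.r.t. $(\rho,\mathbf a)$, $\mathbf a\in(0,\infty)^d$. Assume the accumulation points considered below lie in $[0,\infty)^d$. Then $$\dim_H W(\Psi)\ge\sup\{s(\mathbf t):\mathbf t\in\widehat{\mathcal U}\}.$$ If moreover $\lim_{n\to\infty}\frac{\log\rho(u_{n+1})}{\log\rho(u_n)}=1$, then $$\dim_H W(\Psi)\ge\sup\{s(\mathbf t):\mathbf t\in\mathcal U\}.$$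
   Context: Fix an integer $d\ge1$. For each $1\le i\le d$, $(X_i,|\cdot|_i)$ is a bounded locally compact metric space carrying a Borel probability measure $m_i$. The measure $m_i$ is $\delta_i$-Ahlfors regular ($\delta_i>0$) if there are constants $c,C,r_0>0$ with $c\,r^{\delta_i}\le m_i(B(x,r))\le C\,r^{\delta_i}$ for all $x\in X_i$ and $0<r\le r_0$. Put $X=\prod_{i=1}^dX_i$ with metric $|x-y|=\max_i|x_i-y_i|_i$ and measure $m=\prod_i m_i$; thus a ball in $X$ is $B(x,r)=\prod_iB(x_i,r)$. For $E\subset X_i$ and $\epsilon>0$, $\Delta(E,\epsilon)=\{y\in X_i:\operatorname{dist}(y,E)<\epsilon\}$. $J$ is an infinite countable index set and $\beta:J\to(0,\infty)$, $\alpha\mapsto\beta_\alpha$, satisfies: $\{\alpha:\beta_\alpha<M\}$ is finite for every $M>1$. $\{\ell_n\},\{u_n\}$ are increasing sequences with $\ell_n\le u_n$, $\ell_n\to\infty$, and $J_n=\{\alpha\in J:\ell_n\le\beta_\alpha\le u_n\}$. $\rho:(0,\infty)\to(0,\infty)$ is non-increasing with $\rho(u)\to0$ as $u\to\infty$. For each $i$, $\{\mathcal R_{\alpha,i}:\alpha\in J\}$ are subsets of $X_i$ and $\mathcal R_\alpha=\prod_i\mathcal R_{\alpha,i}$. For $\mathbf b=(b_1,\dots,b_d)\in(0,\infty)^d$ and $r>0$, $\Delta(\mathcal R_\alpha,r^{\mathbf b})=\prod_{i=1}^d\Delta(\mathcal R_{\alpha,i},r^{b_i})$. $\kappa$-scaling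 property ($0\le\kappa<1$): there are constants $c_2,c_3>0$ such that for every $\alpha\in J$, every $x_i\in\mathcal R_{\alpha,i}$ and every $0<\epsilon<r$ (with $r$ sufficiently small), $c_2r^{\delta_i\kappa}\epsilon^{\delta_i(1-\kappa)}\le m_i(B(x_i,r)\cap\Delta(\mathcal R_{\alpha,i},\epsilon))\le c_3r^{\delta_i\kappa}\epsilon^{\delta_i(1-\kappa)}$. Uniform local ubiquity system for rectangles w.r.t. $(\rho,\mathbf a)$: there is $c>0$ such that for every ball $B\subset X$ there is $n_0(B)$ with $m\big(B\cap\bigcup_{\alpha\in J_n}\Delta(\mathcal R_\alpha,\rho(u_n)^{\mathbf a})\big)\ge c\,m(B)$ for all $n\ge n_0(B)$. $W(\Psi)=\{x\in X: x\in\prod_{i=1}^d\Delta(\mathcal R_{\alpha,i},\rho(\beta_\alpha)^{a_i}\psi_i(\beta_\alpha))\text{ for infinitely many }\alpha\in J\}$. $\widehat{\mathcal U}$ is the set of accumulation points of $\big(\frac{\log\psi_1(u_n)}{\log\rho(u_n)},\dots,\frac{\log\psi_d(u_n)}{\log\rho(u_n)}\big)_{n\in\mathbb N}$, and $\mathcal U$ the set of accumulation points of $\big(\frac{\log\psi_1(n)}{\log\rho(n)},\dots,\frac{\log\psi_d(n)}{\log\rho(n)}\big)_{n\in\mathbb N}$. Dimensional number for $\mathbf t\in[0,\infty)^d$: let $\mathcal A=\{a_i,\ a_i+t_i:1\le i\le d\}$. For $A\in\mathcal A$ let $\mathcal K_1=\{k:a_k\ge A\}$, $\mathcal K_2=\{k:a_k+t_k\le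 A\}\setminus\mathcal K_1$, $\mathcal K_3=\{1,\dots,d\}\setminus(\mathcal K_1\cup\mathcal K_2)$, and $$s(\mathbf t)=\min_{A\in\mathcal A}\Big\{\sum_{k\in\mathcal K_1}\delta_k+\sum_{k\in\mathcal K_2}\delta_k+\kappa\sum_{k\in\mathcal K_3}\delta_k+(1-\kappa)\frac{\sum_{k\in\mathcal K_3}a_k\delta_k-\sum_{k\in\mathcal K_2}t_k\delta_k}{A}\Big\}.$$ *)

(* Defs.v *)
Set Warnings "-notation-overridden,-ambiguous-paths,-notation-incompatible-prefix".
From HB Require Import structures.
From mathcomp Require Import all_boot all_order all_algebra.
From mathcomp Require Import all_classical all_reals all_analysis.
Set Implicit Arguments. Unset Strict Implicit. Unset Printing Implicit Defensive.
Import Order.TTheory GRing.Theory Num.Theory.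
Import numFieldNormedType.Exports.
Local Open Scope classical_set_scope.
Local Open Scope ring_scope.

Section Metric.
Variables (R : realType) (T : Type) (D : T -> T -> R).

Definition is_metric : Prop :=
  [/\ forall x y, 0 <= D x y,
      forall x y, D x y = 0 <-> x = y,
      forall x y, D x y = D y x &
      forall x y z, D x z <= D x y + D y z].

Definition oball (x : T) (r : R) : set T := [set y | D x y < r].

Definition dopen : set (set T) :=
  [set A | forall x, A x -> exists2 r : R, 0 < r & oball x r `<=` A].

Definition dbounded : Prop := exists M : R, forall x y, D x y <= M.

(** compactness of a subset (sequential compactness, equivalent for metric spaces) *)
Definition dcompact (K : set T) : Prop :=
  forall u : nat -> T, (forall n, K (u n)) ->
  exists phi : nat -> nat, {homo phi : n m / (n < m)%N} /\
  exists2 y, K y & (fun n => D (u (phi n)) y) @ \oo --> (0 : R).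

Definition dlocally_compact : Prop :=
  forall x, exists K, dcompact K /\ exists2 r : R, 0 < r & oball x r `<=` K.

(** distance to a set (inf over the set, +oo for the empty set) *)
Definition dist_set (y : T) (E : set T) : \bar R :=
  ereal_inf [set (D y e)%:E | e in E].

Definition Delta (E : set T) (eps : R) : set T :=
  [set y | (dist_set y E < eps%:E)%E].

Definition diam (U : set T) : \bar R :=
  ereal_sup [set (D p.1 p.2)%:E | p in U `*` U].

Definition hterm (s : R) (U : set T) : \bar R :=
  (if `[< U = set0 >] then 0 else fine (diam U) `^ s)%:E.

Definition hausdorff_delta (s delta : R) (E : set T) : \bar R :=
  ereal_inf [set (\sum_(0 <= k <oo) hterm s (U k))%E |
     U in [set U : nat -> set T |
            E `<=` \bigcup_k U k /\ forall k, (diam (U k) <= delta%:E)%E]].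

(** s-dimensional Hausdorff measure H^s = lim_{delta->0} H^s_delta = sup_delta *)
Definition hausdorff (s : R) (E : set T) : \bar R :=
  ereal_sup [set hausdorff_delta s delta E | delta in [set delta : R | 0 < delta]].

Definition dimH (E : set T) : \bar R :=
  ereal_inf [set s%:E | s in [set s : R | 0 <= s /\ hausdorff s E = 0%E]].

End Metric.

Definition prodX (d : nat) (dT : 'I_d -> measure_display)
  (T : forall i, measurableType (dT i)) := forall i : 'I_d, T i.


Definition rectangles (d : nat) (dT : 'I_d -> measure_display)
  (T : forall i, measurableType (dT i)) : set (set (prodX T)) :=
  [set A | exists B : forall i, set (T i),
     (forall i, measurable (B i)) /\ A = [set x | forall i, B i (x i)]].

Arguments rectangles {d dT} T.

Definition Xsig (d : nat) (dT : 'I_d -> measure_display)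
  (T : forall i, measurableType (dT i)) := g_sigma_algebraType (rectangles T).

Definition distX (R : realType) (d : nat) (T : 'I_d -> Type)
  (dist : forall i, T i -> T i -> R) (x y : forall i, T i) : R :=
  \big[Num.max/0]_(i < d) dist i (x i) (y i).

Definition accum_pts (R : realType) (d : nat) (v : nat -> 'I_d -> R) : set ('I_d -> R) :=
  [set t | forall eps : R, 0 < eps -> forall N : nat,
     exists2 n : nat, (N <= n)%N & forall i, `|v n i - t i| < eps].

Definition s_at (R : realType) (d : nat) (delta a t : 'I_d -> R) (kappa A : R) : R :=
  \sum_(k < d | A <= a k) delta k
  + \sum_(k < d | (a k + t k <= A) && ~~ (A <= a k)) delta k
  + kappa * \sum_(k < d | ~~ (A <= a k) && ~~ (a k + t k <= A)) delta k
  + (1 - kappa) *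
     ((\sum_(k < d | ~~ (A <= a k) && ~~ (a k + t k <= A)) a k * delta k
       - \sum_(k < d | (a k + t k <= A) && ~~ (A <= a k)) t k * delta k) / A).

Definition dimnum (R : realType) (d : nat) (delta a : 'I_d -> R) (kappa : R)
  (t : 'I_d -> R) : \bar R :=
  (\big[Order.min/+oo]_(i < d)
     Order.min (s_at delta a t kappa (a i))%:E (s_at delta a t kappa (a i + t i))%:E)%E.

(** balls in X for the max metric: B(x,r) = prod_i B(x_i,r) *)
Definition ballX (R : realType) (d : nat) (T : 'I_d -> Type)
  (dist : forall i, T i -> T i -> R) (x : forall i, T i) (r : R) : set (forall i, T i) :=
  [set y | forall i, dist i (x i) (y i) < r].

(** Delta(R_alpha, r^b) = prod_i Delta(R_{alpha,i}, r^{b_i}) with r^{b_i} given as rr i *)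
Definition DeltaX (R : realType) (d : nat) (T : 'I_d -> Type)
  (dist : forall i, T i -> T i -> R) (E : forall i, set (T i)) (rr : 'I_d -> R) :
  set (forall i, T i) :=
  [set y | forall i, Delta (dist i) (E i) (rr i) (y i)].

(* Main.v *)
Require Import Defs.
From HB Require Import structures.
From mathcomp Require Import all_boot all_order all_algebra.
From mathcomp Require Import all_classical all_reals all_analysis.
From mathcomp Require Import ring lra.

(* Fix [t] and [s < s(t)], and let [N] be a scale at which [psi_i(u_N) >= rho^(t_i + eta)],
   where [rho = rho(u_N)]. By ubiquity a ball contains of the order of
   [m(B) / prod_i rho^(a_i delta_i)] disjoint rectangles of sides [rho^a_i] centred near
   resonant sets. Spreading the mass of the ball evenly over their intersections with the
   [rho^(a_i + t_i + eta)]-neighbourhoods of the resonant sets gives a measure that puts at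
   most [C rho^(sum_i delta_i (A - (1 - kappa) min (max (A - a_i) 0) (t_i + eta)))] on a ball of
   radius [rho^A]. Divided by [A], that exponent is minimal at some [A] in
   [{a_i, a_i + t_i}] and the minimum is the dimensional number, so the mass is at most
   [C e^s] at every radius [e], uniformly in the ball and in [N].

   Iterating this inside small balls gives absolutely continuous measures [mu_n] on nested
   sets [S_n], with the same total mass and the same bound [mu_n(B(y,e)) <= C' e^sigma], for
   any [sigma < s]. No limit measure is needed: if balls [B_k] have small [sum_k r_k^sigma],
   each [mu_n] sees a point of [S_n] outside [B_0, ..., B_(n-1)], and by local compactness
   these points accumulate at a point of [W(Psi)] outside every [B_k].

   An accumulation point along all integers is reduced to the scales [u_k] by taking
   [u_k <= n < u_(k+1)]: [psi_i(u_k) >= psi_i(n)], and [log rho(n)] and [log rho(u_k)] are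
   asymptotically equal. *)

Set Implicit Arguments. Unset Strict Implicit. Unset Printing Implicit Defensive.
Import Order.TTheory GRing.Theory Num.Theory.
Import numFieldNormedType.Exports.
Local Open Scope classical_set_scope.
Local Open Scope ring_scope.

(** * Exponents *)

Section Exponents.
Variables (R : realType) (d : nat) (delta a : 'I_d -> R) (kappa : R).
Hypothesis delta_gt0 : forall i, 0 < delta i.
Hypothesis a_gt0 : forall i, 0 < a i.
Hypothesis kappa01 : 0 <= kappa < 1.

(** For [0 <= t], the length of the part of [[a, a + t]] lying below [A]. *)
Definition clamp (a t A : R) : R := Num.min (Num.max (A - a) 0) t.

(* [A] times the quantity minimised in [dimnum] (see [exponent_s_at]), in a form that is
   visibly Lipschitz in [t] and piecewise affine in [A]. *)
Definition exponent (t : 'I_d -> R) (A : R) : R :=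
  \sum_(k < d) delta k * (A - (1 - kappa) * clamp (a k) (t k) A).

Lemma clampP (a0 t A : R) : 0 <= t ->
  [\/ A <= a0 /\ clamp a0 t A = 0,
      (a0 <= A /\ A <= a0 + t) /\ clamp a0 t A = A - a0
    | a0 + t <= A /\ clamp a0 t A = t].
Proof.
move=> t0; rewrite /clamp.
have [h|/ltW h] := leP A a0.
  by apply: Or31; split=> //; rewrite max_r ?subr_le0// min_l.
have [h'|/ltW h'] := leP A (a0 + t).
  by apply: Or32; split=> //; rewrite max_l ?subr_ge0// min_l// lerBlDl.
by apply: Or33; split=> //; rewrite max_l ?subr_ge0// min_r// lerBrDl.
Qed.

(** The three index sets of [s_at] are where the clamp equals [0], [t k] and [A - a k] respectively;
    multiplying by [A] clears the denominator. *)
Lemma exponent_s_at (t : 'I_d -> R) (A : R) : (forall i, 0 <= t i) -> 0 < A ->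
  exponent t A = A * s_at delta a t kappa A.
Proof.
move=> t0 A0; have Ane : A != 0 by rewrite gt_eqF.
rewrite /s_at /exponent.
have -> (x y z u v : R) : A * (x + y + kappa * z + (1 - kappa) * ((u - v) / A)) =
   A * x + A * y + A * (kappa * z) + (1 - kappa) * u - (1 - kappa) * v by field.
(* The conditional sums become full sums with zero terms, so that the identity can be checked index
   by index. *)
rewrite !mulr_sumr ![in RHS](big_mkcond (fun _ => _ && _)) ![in RHS](big_mkcond (fun k => A <= a k)).
rewrite -sumrN -!big_split /=; apply: eq_bigr => k _.
have tk := t0 k; rewrite /clamp.
case: (leP A (a k)) => h1; case: (leP (a k + t k) A) => h2 /=.
- by rewrite max_r ?subr_le0// min_l//; ring.
- by rewrite max_r ?subr_le0// min_l//; ring.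
- by rewrite max_l ?subr_ge0 ?ltW// min_r ?lerBrDl//; ring.
- by rewrite max_l ?subr_ge0 ?ltW// min_l ?lerBlDl ?ltW//; ring.
Qed.

(** The kinks of [exponent t], indexed by a finite type so that extremal ones can be selected. *)
Definition breakpoint (t : 'I_d -> R) (x : 'I_d * bool) : R :=
  if x.2 then a x.1 + t x.1 else a x.1.

Lemma exponent_low (t : 'I_d -> R) A : (forall i, 0 <= t i) ->
  (forall i, A <= a i) -> exponent t A = (\sum_k delta k) * A.
Proof.
move=> t0 h; rewrite /exponent mulr_suml; apply: eq_bigr => k _.
rewrite /clamp max_r ?subr_le0// min_l//; ring.
Qed.

Lemma exponent_high (t : 'I_d -> R) A : (forall i, 0 <= t i) ->
  (forall i, a i + t i <= A) ->
  exponent t A = (\sum_k delta k) * A - (1 - kappa) * \sum_k delta k * t k.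
Proof.
move=> t0 h; rewrite /exponent mulr_suml mulr_sumr -sumrB; apply: eq_bigr => k _.
have hk := h k; have tk := t0 k.
rewrite /clamp max_l ?subr_ge0 ?min_r ?lerBrDl//; first ring.
by apply: le_trans hk; rewrite lerDl.
Qed.

(** With no breakpoint strictly between [p] and [q], every clamp is affine there. The interpolation
    is cross-multiplied, so that [p = q] is allowed. *)
Lemma exponent_affine (t : 'I_d -> R) (p q A : R) : (forall i, 0 <= t i) ->
  p <= A -> A <= q -> (forall x, breakpoint t x <= p \/ q <= breakpoint t x) ->
  (q - p) * exponent t A = (q - A) * exponent t p + (A - p) * exponent t q.
Proof.
move=> t0 pA Aq h; rewrite /exponent !mulr_sumr -big_split/=.
apply: eq_bigr => k _.
have tk := t0 k.
suff H : (q - p) * clamp (a k) (t k) A =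
    (q - A) * clamp (a k) (t k) p + (A - p) * clamp (a k) (t k) q.
  transitivity (delta k * ((q - p) * A - (1 - kappa) * ((q - p) * clamp (a k) (t k) A))).
    by ring.
  by rewrite H; ring.
have := h (k, true); have := h (k, false); rewrite /breakpoint /=.
case: (clampP (a k) A tk) => -[? ->]; case: (clampP (a k) p tk) => -[? ->];
  case: (clampP (a k) q tk) => -[? ->] h1 h2; nra.
Qed.

Hypothesis d_gt0 : (0 < d)%N.

(** [exponent t A - s * A] is affine between consecutive breakpoints, so its sign there is decided
    at the breakpoints. Below the first and above the last one its slope is [\sum_k delta k - s],
    which is nonnegative. *)
Lemma exponent_ge (t : 'I_d -> R) (s : R) : (forall i, 0 <= t i) ->
  (forall i, s <= s_at delta a t kappa (a i)) ->
  (forall i, s <= s_at delta a t kappa (a i + t i)) ->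
  forall A, 0 < A -> s * A <= exponent t A.
Proof.
move=> t0 h1 h2 A A0.
have bp_gt0 x : 0 < breakpoint t x.
  by rewrite /breakpoint; case: ifP => _; rewrite ?ltr_wpDr.
have hbp x : s * breakpoint t x <= exponent t (breakpoint t x).
  rewrite exponent_s_at// mulrC ler_pM2l//.
  case: x => i []; rewrite /breakpoint /=; [exact: h2|exact: h1].
have x0 : 'I_d * bool := (Ordinal d_gt0, true).
(* At the smallest [a i] every clamp vanishes, so the bound there compares [s * a i] with [a i]
   times the sum of the [delta k]. *)
have sd : s <= \sum_k delta k.
  case: (arg_minP (P := predT) a (erefl true : predT (Ordinal d_gt0))) => i0 _ hi.
  have := hbp (i0, false); rewrite /breakpoint /= exponent_low//; last first.
    by move=> j; exact: hi.
  by rewrite ler_pM2r.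
have [[x xA]|noL] := pselect (exists x, breakpoint t x <= A); last first.
  rewrite exponent_low ?ler_wpM2r// ?ltW// => i; rewrite leNgt; apply/negP => h.
  by apply: noL; exists (i, false); exact: ltW.
have [[y yA]|noU] := pselect (exists x, A <= breakpoint t x); last first.
  case: (arg_maxP (P := predT) (breakpoint t) (erefl true : predT x)) => z _ hz.
  have := hbp z; rewrite !exponent_high //; first last.
  - by move=> i; exact: (hz (i, true)).
  - move=> i; rewrite leNgt; apply/negP => h.
    by apply: noU; exists (i, true); exact: ltW.
  have zA : breakpoint t z <= A.
    by rewrite leNgt; apply/negP => h; apply: noU; exists z; exact: ltW.
  nra.
case: (arg_maxP (P := fun x => breakpoint t x <= A) (breakpoint t) xA) => p pA hp.
case: (arg_minP (P := fun x => A <= breakpoint t x) (breakpoint t) yA) => q qA hq.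
have := exponent_affine t0 pA qA.
have Hpq z : breakpoint t z <= breakpoint t p \/ breakpoint t q <= breakpoint t z.
  by case: (leP (breakpoint t z) A) => [/hp|/ltW/hq]; [left|right].
move=> /(_ Hpq).
have := hbp p; have := hbp q.
have [|ne] := eqVneq (breakpoint t p) (breakpoint t q).
  move=> e; have -> : A = breakpoint t q by apply/le_anti; rewrite qA -e pA.
  by [].
have lt : breakpoint t p < breakpoint t q by rewrite lt_neqAle ne (le_trans pA qA).
move=> hq' hp' e.
rewrite -(ler_pM2l (_ : 0 < breakpoint t q - breakpoint t p)) ?subr_gt0// e.
have := subr_ge0 A (breakpoint t q); rewrite qA => qA'.
have := subr_ge0 (breakpoint t p) A; rewrite pA => pA'.
have := ler_wpM2l qA' hp'.
have := ler_wpM2l pA' hq'.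
nra.
Qed.

(** Up to the smallest [a i] the exponent does not see [t]. Beyond it, raising every [t i] by [eta]
    costs at most [eta * \sum_k delta k], which [eta] makes equal to [(s - s') * a i0] and hence
    smaller than [(s - s') * A]. *)
Lemma exponent_perturb (t : 'I_d -> R) (s s' : R) : (forall i, 0 <= t i) -> s' < s ->
  (forall A, 0 < A -> s * A <= exponent t A) ->
  exists2 eta, 0 < eta &
    forall A, 0 < A -> s' * A <= exponent (fun i => t i + eta) A.
Proof.
move=> t0 ss h.
case: (arg_minP (P := predT) a (erefl true : predT (Ordinal d_gt0))) => i0 _ hi.
pose D := \sum_k delta k.
have D0 : 0 < D.
  rewrite /D (bigD1 i0)//= ltr_pwDl// sumr_ge0// => k _; exact: ltW.
pose eta := (s - s') * a i0 / D.
have eta0 : 0 < eta by rewrite /eta !mulr_gt0 ?invr_gt0 ?subr_gt0.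
exists eta => //.
case/andP: kappa01 => kap0 kap1.
have k0 : 0 <= 1 - kappa by lra.
have k1 : 1 - kappa <= 1 by lra.
move=> A A0; have [Ai|Ai] := leP A (a i0).
  have Aj j : A <= a j by apply: le_trans Ai (hi _ _).
  rewrite exponent_low//; last by move=> k; rewrite addr_ge0// ltW.
  have := h _ A0; rewrite exponent_low//; apply: le_trans.
  by rewrite ler_wpM2r ?ltW.
apply: (@le_trans _ _ (exponent t A - D * eta)).
  have -> : D * eta = (s - s') * a i0 by rewrite /eta; field; rewrite gt_eqF.
  have := h _ A0; nra.
rewrite /exponent /D mulr_suml -sumrB; apply: ler_sum => k _.
have tk := t0 k.
rewrite -mulrBr ler_pM2l//.
have tk' : 0 <= t k + eta by rewrite addr_ge0// ltW.
have cc : clamp (a k) (t k + eta) A <= clamp (a k) (t k) A + eta.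
  case: (clampP (a k) A tk) => -[? ->]; case: (clampP (a k) A tk') => -[? ->]; lra.
have := ler_wpM2l k0 cc; have := mulr_ge0 kap0 (ltW eta0); lra.
Qed.

End Exponents.

(** * Finitely additive contents and maximal separated families *)

Section Contents.
Context {R : realType} {disp : measure_display} {X : measurableType disp}.

(** Finite additivity is enough because only finite families are ever summed; real values keep the
    arithmetic in the field. *)
Definition fin_content (mu : set X -> R) : Prop :=
  (forall A, measurable A -> 0 <= mu A) /\
  (forall A B, measurable A -> measurable B -> A `&` B = set0 ->
     mu (A `|` B) = mu A + mu B).

Variable mu : set X -> R.
Hypothesis muP : fin_content mu.

Lemma fin_content_ge0 A : measurable A -> 0 <= mu A.
Proof. exact: muP.1. Qed.

Lemma fin_content0 : mu set0 = 0.
Proof.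
have := muP.2 set0 set0 measurable0 measurable0 (setI0 _); rewrite setU0; lra.
Qed.

Lemma fin_contentD A B : measurable A -> measurable B -> B `<=` A ->
  mu A = mu B + mu (A `\` B).
Proof.
move=> mA mB BA; rewrite -muP.2//; last 2 first.
- exact: measurableD.
- by rewrite setDIK.
by rewrite setDUK.
Qed.

Lemma fin_content_le A B : measurable A -> measurable B -> A `<=` B -> mu A <= mu B.
Proof.
move=> mA mB AB; rewrite (fin_contentD mB mA AB) lerDl fin_content_ge0//.
exact: measurableD.
Qed.

Lemma fin_contentU A B : measurable A -> measurable B -> mu (A `|` B) <= mu A + mu B.
Proof.
move=> mA mB; rewrite (fin_contentD (measurableU _ _ mA mB) mA); last by move=> x; left.
rewrite lerD2l fin_content_le//; first by apply: measurableD => //; exact: measurableU.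
by move=> x [[]].
Qed.

Lemma fin_content_bigU (I : choiceType) (s : seq I) (Q : pred I) (F : I -> set X) A :
  measurable A -> (forall i, measurable (F i)) ->
  A `<=` [set x | exists i, [/\ i \in s, Q i & F i x]] ->
  mu A <= \sum_(i <- s | Q i) mu (F i).
Proof.
move=> mA mF; elim: s A mA => [|i s IH] A mA AF.
  rewrite big_nil (_ : A = set0) ?fin_content0//.
  by apply/seteqP; split => // x /AF [j []].
rewrite big_cons; case: ifPn => Qi.
  apply: (@le_trans _ _ (mu (F i) + mu (A `\` F i))).
    apply: le_trans (fin_contentU (mF i) (measurableD mA (mF i))).
    apply: fin_content_le => //.
      by apply: measurableU => //; exact: measurableD.
    by move=> x Ax; have [|] := pselect (F i x); [left|right].
  rewrite lerD2l; apply: IH; first exact: measurableD.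
  move=> x [/AF [j []]]; rewrite inE => /orP[/eqP -> //|js Qj Fj _].
  by exists j.
apply: IH => // x /AF [j []]; rewrite inE => /orP[/eqP ->|js Qj Fj].
  by rewrite (negbTE Qi).
by exists j.
Qed.

Lemma fin_content_sum (I : eqType) (s : seq I) (Q : pred I) (F : I -> set X) :
  uniq s -> (forall i, measurable (F i)) ->
  (forall i j, Q i -> Q j -> i != j -> F i `&` F j = set0) ->
  let U := [set x | exists i, [/\ i \in s, Q i & F i x]] in
  measurable U /\ mu U = \sum_(i <- s | Q i) mu (F i).
Proof.
move=> + mF dF; elim: s => [_|i s IH /= /andP[si us]] /=.
  rewrite big_nil (_ : [set x | _] = set0) ?fin_content0//.
  by apply/seteqP; split => // x [j []].
have [mU eU] := IH us; set U := [set x | _] in mU eU.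
rewrite big_cons; case: ifPn => Qi; last first.
  rewrite (_ : [set x | _] = U)//; apply/seteqP; split => x [j []].
    by rewrite inE => /orP[/eqP ->|js Qj Fj]; [rewrite (negbTE Qi)|exists j].
  by move=> js Qj Fj; exists j; rewrite inE js orbT.
rewrite (_ : [set x | _] = F i `|` U); last first.
  apply/seteqP; split => x.
    by move=> [j []]; rewrite inE => /orP[/eqP ->|js Qj Fj]; [left|right; exists j].
  move=> [Fi|[j [js Qj Fj]]]; first by exists i; rewrite inE eqxx.
  by exists j; rewrite inE js orbT.
split; first exact: measurableU.
rewrite muP.2 ?eU//; apply/seteqP; split => // x [Fi [j [js Qj Fj]]].
have ij : i != j by apply: contraNneq si => ->.
by have := dF _ _ Qi Qj ij; rewrite -subset0; apply; split; eassumption.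
Qed.

Lemma fin_content_sum_le (I : eqType) (s : seq I) (Q : pred I) (F : I -> set X) B :
  uniq s -> measurable B -> (forall i, measurable (F i)) ->
  (forall i j, Q i -> Q j -> i != j -> F i `&` F j = set0) ->
  (forall i, Q i -> F i `<=` B) ->
  \sum_(i <- s | Q i) mu (F i) <= mu B.
Proof.
move=> us mB mF dF FB; have [mU <-] := fin_content_sum us mF dF.
by apply: fin_content_le => // x [i [_ Qi]]; exact: FB.
Qed.

End Contents.

Section ContentCombinations.
Context {R : realType} {disp : measure_display} {X : measurableType disp}.

(** Both the local measures and the measures of the Cantor construction are such weighted sums of
    restrictions. *)
Lemma fin_content_combination (I : finType) (w : I -> R) (mu : I -> set X -> R) (S : I -> set X) :
  (forall i, 0 <= w i) -> (forall i, fin_content (mu i)) ->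
  (forall i, measurable (S i)) ->
  fin_content (fun A => \sum_i w i * mu i (A `&` S i)).
Proof.
move=> w0 muP mS; split.
  move=> A mA; apply: sumr_ge0 => i _; rewrite mulr_ge0//.
  exact: (fin_content_ge0 (muP i) (measurableI _ _ mA (mS i))).
move=> A B mA mB AB; rewrite -big_split/=; apply: eq_bigr => i _.
rewrite setIUl (muP i).2 ?mulrDr//; try exact: measurableI.
by rewrite setIACA AB set0I.
Qed.

End ContentCombinations.

Section MaximalFamilies.
Variables (X : Type) (near : X -> X -> Prop) (S : set X).

(** [near] is abstract because it stands for closeness in the metric in one place and for closeness
    at a different scale in each coordinate in another. *)
Definition separated_family (K : nat) (f : 'I_K -> X) : Prop :=
  (forall i, S (f i)) /\ forall i j, i != j -> ~ near (f i) (f j).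

(** A family of maximal cardinality is a net: a point near none of its members could be added to
    it. *)
Lemma maximal_separated_family (B : nat) :
  (forall x y, near x y -> near y x) ->
  (forall K (f : 'I_K -> X), separated_family f -> (K <= B)%N) ->
  exists K (f : 'I_K -> X), separated_family f /\
    forall x, S x -> exists i, near (f i) x.
Proof.
move=> sym bnd.
pose P (K : nat) := `[< exists f : 'I_K -> X, separated_family f >].
have P0 : exists K, P K.
  exists 0%N; apply/asboolP; exists (fun i : 'I_0 => False_rect X (notF (ltn_ord i))).
  by split; case.
have PB K : P K -> (K <= B)%N by move=> /asboolP[f]; exact: bnd.
case: (ex_maxnP P0 PB) => K /asboolP[f [fS fsep]] maxK.
exists K, f; split=> // x Sx; apply: contrapT => noi.
have : P K.+1.
  apply/asboolP.
  exists (fun i => if unlift ord0 i is Some j then f j else x); split.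
    by move=> i; case: unliftP => [j _|_].
  move=> i j; case: (unliftP ord0 i) => [i' ->|->]; case: (unliftP ord0 j) => [j' ->|->].
  - by rewrite (inj_eq lift_inj) => /fsep.
  - by move=> _ h; apply: noi; exists i'.
  - by move=> _ h; apply: noi; exists j'; exact: sym.
  - by rewrite eqxx.
by move=> /maxK; rewrite ltnn.
Qed.

End MaximalFamilies.

(** * The Cantor construction *)

(** The spare factor [e ^ (s - sigma)] tends to zero with [e] and absorbs the constants. *)
Lemma powR_small_scale (R : realType) (K C lam sigma s : R) : 0 < C -> 0 < lam -> sigma < s ->
  exists2 eta, 0 < eta & forall e, 0 < e -> e < eta -> K * e `^ s <= C * (lam * e) `^ sigma.
Proof.
move=> C0 l0 ss; set c := C * lam `^ sigma / (`|K| + 1).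
have c0 : 0 < c by rewrite !mulr_gt0 ?invr_gt0 ?powR_gt0// ltr_wpDl.
exists (c `^ (s - sigma)^-1); first exact: powR_gt0.
move=> e e0 ee; have K1 : 0 < `|K| + 1 by rewrite ltr_wpDl.
have : e `^ (s - sigma) <= c.
  have -> : c = (c `^ (s - sigma)^-1) `^ (s - sigma).
    by rewrite -powRrM mulVf ?powRr1 ?ltW// subr_eq0 gt_eqF.
  by apply: ge0_ler_powR; rewrite ?nnegrE ?powR_ge0 ?subr_ge0 ?ltW.
have -> : e `^ s = e `^ sigma * e `^ (s - sigma).
  by rewrite -powRD ?subrKC// (gt_eqF e0) implybT.
rewrite powRM ?(ltW l0) ?(ltW e0)// => h.
have e1 := powR_gt0 sigma e0.
have : `|K| * e `^ (s - sigma) <= C * lam `^ sigma.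
  apply: (@le_trans _ _ ((`|K| + 1) * c)).
    by apply: ler_pM => //; rewrite ?powR_ge0// lerDl.
  by rewrite /c mulrC divfK// gt_eqF.
move=> h'; have h2 : K * e `^ (s - sigma) <= C * lam `^ sigma.
  by apply: le_trans h'; rewrite ler_wpM2r ?powR_ge0// ler_norm.
by have := ler_wpM2l (ltW e1) h2; lra.
Qed.

Lemma bigmin_gt0 (R : realType) (I : finType) (tau : I -> R) :
  (forall i, 0 < tau i) -> exists2 t, 0 < t & forall i, t <= tau i.
Proof.
move=> t0; exists (\big[Num.min/1]_i tau i); last by move=> i; exact: bigmin_le.
by apply: lt_bigmin => //; exact: ltr01.
Qed.

Section Cantor.
Context {R : realType} {disp : measure_display} {X : measurableType disp}.
Variables (D : X -> X -> R) (P : set X -> R) (F : nat -> set X).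
Variables (Q cQ CQ r0 sigma s C' r1 : R).
Hypothesis D_metric : is_metric D.
Hypothesis measurable_oball : forall x r, 0 < r -> measurable (oball D x r).
Hypothesis P_content : fin_content P.
Hypothesis cQ_gt0 : 0 < cQ.
Hypothesis CQ_gt0 : 0 < CQ.
Hypothesis r0_gt0 : 0 < r0.
Hypothesis r1_gt0 : 0 < r1.
Hypothesis C'_gt0 : 0 < C'.
Hypothesis P_ge : forall x r, 0 < r -> r <= r0 -> cQ * r `^ Q <= P (oball D x r).
Hypothesis P_le : forall x r, 0 < r -> P (oball D x r) <= CQ * r `^ Q.
Hypothesis sigma_ge0 : 0 <= sigma.
Hypothesis sigma_s : sigma < s.
Hypothesis sigma_Q : sigma < Q.

(** [C'] and [s] are the same for all [n], [x] and [r], whereas [M] and [tau] may vary: they only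
    influence how small the next scale must be. The margin [tau] around [S] lets limit points stay
    in [F n]. *)
Definition local_measure (n : nat) (x : X) (r : R) (nu : set X -> R) (S : set X) (tau M : R) :=
  [/\ [/\ fin_content nu, measurable S, 0 < tau & 0 <= M],
      forall y, S y -> oball D y tau `<=` F n `&` oball D x r,
      nu (~` S) = 0 /\ nu setT = P (oball D x r),
      forall A, measurable A -> nu A <= M * P A &
      forall y e, 0 < e -> e < r -> nu (oball D y e) <= C' * e `^ s].

Hypothesis local_measure_exists : forall n x r, 0 < r -> r <= r1 ->
  exists nu S tau M, local_measure n x r nu S tau M.

Let Dsym x y : D x y = D y x. Proof. by case: D_metric. Qed.
Let Dtri x y z : D x z <= D x y + D y z. Proof. by case: D_metric. Qed.
Let Dxx x : D x x = 0. Proof. by case: D_metric => _ h _ _; apply/h. Qed.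

(** Serves as Frostman constant for the initial restriction of [P]: [CQ] covers radii up to [1],
    [P setT] the larger ones. *)
Definition CF : R := CQ + P setT.

(** A Frostman condition in which losses are charged to the factor [lam] on the radius, so that [CF]
    never changes along the construction. *)
Definition frostman (mu : set X -> R) (S : set X) (tau M lam : R) :=
  [/\ [/\ fin_content mu, measurable S, 0 < tau & 0 <= M],
      mu (~` S) = 0,
      forall A, measurable A -> mu A <= M * P A &
      forall y e, 0 < e -> mu (oball D y e) <= CF * (lam * e) `^ sigma].

Let PT_ge0 : 0 <= P setT. Proof. exact: fin_content_ge0. Qed.
Let CF_gt0 : 0 < CF. Proof. exact: ltr_pwDl. Qed.

(** Balls of radius [r / 2] around separated points are disjoint, and each has mass bounded
    below. *)
Lemma separated_card (S : set X) r K (f : 'I_K -> X) : 0 < r -> r <= r0 ->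
  separated_family (fun x y => D x y < r) S f ->
  K%:R * (cQ * (r / 2) `^ Q) <= P setT.
Proof.
move=> rp rr0 [_ fsep].
have r2 : 0 < r / 2 by rewrite divr_gt0.
apply: le_trans (fin_content_sum_le P_content (index_enum_uniq 'I_K) (Q := predT)
   (F := fun i => oball D (f i) (r / 2)) measurableT _ _ _) => //.
- have -> : K%:R * (cQ * (r / 2) `^ Q) = \sum_(i < K) cQ * (r / 2) `^ Q.
    by rewrite sumr_const card_ord mulr_natl.
  apply: ler_sum => i _.
  by apply: P_ge => //; lra.
- by move=> i; exact: measurable_oball.
- move=> i j _ _ ij; apply/seteqP; split=> // x [/= h1 h2].
  apply: (fsep i j ij); apply: le_lt_trans (Dtri _ x _) _.
  by move: h1 h2; rewrite /oball /= (Dsym x (f j)); lra.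
Qed.

Lemma finite_net (S : set X) r : 0 < r -> r <= r0 ->
  exists K (f : 'I_K -> X), separated_family (fun x y => D x y < r) S f /\
    forall x, S x -> exists i, D (f i) x < r.
Proof.
move=> rp rr0; pose c := cQ * (r / 2) `^ Q.
have c0 : 0 < c by rewrite mulr_gt0// powR_gt0// divr_gt0.
apply: (@maximal_separated_family _ _ S (Num.trunc (P setT / c)).+1).
  by move=> x y; rewrite Dsym.
move=> K f /(separated_card rp rr0).
rewrite -/c -ler_pdivlMr// => h.
rewrite -(ler_nat R); apply: le_trans h _; apply/ltW.
exact: truncnS_gt.
Qed.

(** Disjointified balls: each point goes to the net point of least index near it, so that the masses
    of the cells add up. *)
Definition cell (S : set X) (r : R) K (f : 'I_K -> X) (p : 'I_K) : set X :=
  (S `&` oball D (f p) r) `\` \bigcup_(q in [set q : 'I_K | (q < p)%N]) oball D (f q) r.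

Lemma measurable_cell S r K (f : 'I_K -> X) p : 0 < r -> measurable S ->
  measurable (cell S r f p).
Proof.
move=> r_gt0 mS; apply: measurableD.
  by apply: measurableI => //; exact: measurable_oball.
apply: fin_bigcup_measurable; first exact: finite_finset.
by move=> q _; exact: measurable_oball.
Qed.

Lemma cell_disjoint S r K (f : 'I_K -> X) p q : p != q ->
  cell S r f p `&` cell S r f q = set0.
Proof.
wlog pq : p q / (p < q)%N.
  move=> h pq; case: (ltngtP p q) => [lt|lt|e]; first exact: h.
    by rewrite setIC; apply: h => //; rewrite eq_sym.
  by rewrite (val_inj e) eqxx in pq.
move=> _; apply/seteqP; split=> // x [[[_ hp] _] [_ h]].
by apply: h; exists p.
Qed.

Lemma cell_cover S r K (f : 'I_K -> X) : (forall x, S x -> exists i, D (f i) x < r) ->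
  forall x, S x -> exists i, cell S r f i x.
Proof.
move=> h x Sx; have [i hi] := h x Sx.
case: (arg_minnP (P := fun i : 'I_K => D (f i) x < r) (fun i => val i) hi) => p hp minp.
exists p; split=> // -[q /= qp hq].
by have := minp q hq; rewrite leqNgt qp.
Qed.

(* The mass of each cell is moved into the ball of radius [r / 2] around its net point.
   At radii [e >= eta] the new measure is compared with [mu] at radius [e + 2 r], for
   [r / 2 <= e < eta] the bound [mu <= M P] suffices because [sigma < Q], and below [r / 2]
   the local measures decide because [sigma < s]. *)
Lemma frostman_step n mu S tau M lam lam' : 0 < lam -> lam < lam' ->
  frostman mu S tau M lam ->
  exists mu' S' tau' M', [/\ frostman mu' S' tau' M' lam', mu' setT = mu setT &
    forall y, S' y -> oball D y tau' `<=`
      F n `&` [set z | exists2 x, S x & D x z < tau / 2]].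
Proof.
move=> lam0 ll [[muP mS tau0 M0] muS muM muF].
have lam'0 : 0 < lam' := lt_trans lam0 ll.
(* [eta1] serves [r / 2 <= e], where [e + 2 * r <= 5 * e]; [eta2] serves [e < r / 2], where radius
   [3 * r] is compared with [r / 2], six times smaller. Neither depends on [r], which is chosen
   afterwards. *)
have [eta1 eta10 He1] := powR_small_scale (M * CQ * 5 `^ Q) CF_gt0 lam'0 sigma_Q.
have [eta2 eta20 He2] := powR_small_scale (M * CQ * 6 `^ Q / cQ * C') CF_gt0 lam'0 sigma_s.
pose eta := Num.min eta1 eta2.
have eta0 : 0 < eta by rewrite lt_min eta10.
(* With [r <= h], [lam * (e + 2 * r) <= lam' * e] for all [e >= eta]. *)
pose h := (lam' - lam) * eta / (2 * lam).
have h0 : 0 < h by rewrite !mulr_gt0 ?invr_gt0 ?subr_gt0 ?mulr_gt0.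
pose r := Num.min (Num.min tau r0) (Num.min r1 h).
have r_gt0 : 0 < r by rewrite !lt_min tau0 r0_gt0 r1_gt0 h0.
have [rtau rr0 rr1 rh] : [/\ r <= tau, r <= r0, r <= r1 & r <= h].
  by rewrite /r; split; rewrite !ge_min lexx ?orbT.
have r2 : 0 < r / 2 by rewrite divr_gt0.
have [K [f [[fS fsep] fcov]]] := finite_net S r_gt0 rr0.
pose LM p (g : (set X -> R) * set X * R * R) :=
  local_measure n (f p) (r / 2) g.1.1.1 g.1.1.2 g.1.2 g.2.
have /choice[g gP] p : exists g, LM p g.
  have [|nu [S1 [t1 [M1 hh]]]] := @local_measure_exists n (f p) (r / 2) r2; first lra.
  by exists (nu, S1, t1, M1).
pose nu p := (g p).1.1.1; pose S1 p := (g p).1.1.2.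
pose t1 p := (g p).1.2; pose M1 p := (g p).2.
have {}gP p : local_measure n (f p) (r / 2) (nu p) (S1 p) (t1 p) (M1 p) := gP p.
pose V := cell S r f.
have mV p : measurable (V p) by exact: measurable_cell.
(* [nu p] has the total mass of [P] on the ball, so [w p * nu p] carries exactly the mass of the
   cell [V p]. *)
pose w p := mu (V p) / P (oball D (f p) (r / 2)).
have Bp_ge p : cQ * (r / 2) `^ Q <= P (oball D (f p) (r / 2)).
  by apply: P_ge => //; lra.
have cr0 : 0 < cQ * (r / 2) `^ Q by rewrite mulr_gt0// powR_gt0.
have Bp0 p : 0 < P (oball D (f p) (r / 2)) by exact: lt_le_trans (Bp_ge p).
have muV0 p : 0 <= mu (V p) by exact: fin_content_ge0.
have w0 p : 0 <= w p by rewrite divr_ge0// ltW.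
have nuP p : fin_content (nu p) by have [[]] := gP p.
have mS1 p : measurable (S1 p) by have [[]] := gP p.
have [t t_gt0 tt] : exists2 t, 0 < t & forall p, t <= t1 p.
  by apply: bigmin_gt0 => p; have [[]] := gP p.
have nu_split p A : measurable A -> nu p (A `&` S1 p) = nu p A.
  move=> mA; have [_ _ [nuS _] _ _] := gP p.
  have -> : nu p A = nu p (A `&` S1 p) + nu p (A `\` S1 p).
    rewrite (fin_contentD (nuP p) mA (measurableI _ _ mA (mS1 p))); last by move=> x [].
    by rewrite setDIr setDv set0U.
  suff -> : nu p (A `\` S1 p) = 0 by rewrite addr0.
  have mD : measurable (A `\` S1 p) by exact: measurableD.
  apply/eqP; rewrite eq_le fin_content_ge0// andbT -nuS.
  by apply: fin_content_le => //; exact: measurableC.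
pose mu' A := \sum_p w p * nu p (A `&` S1 p).
pose S' := \bigcup_(p in [set: 'I_K]) S1 p.
have wnu p A : measurable A -> w p * nu p (A `&` S1 p) <= mu (V p).
  move=> mA; rewrite nu_split//.
  apply: (@le_trans _ _ (w p * nu p setT)).
    by apply: ler_wpM2l => //; apply: fin_content_le.
  have [_ _ [_ ->] _ _] := gP p.
  by rewrite /w divfK// gt_eqF.
have hit p y e : oball D y e `&` S1 p !=set0 -> D y (f p) < e + r / 2.
  move=> [x [xe xS]]; have [[_ _ tp _] /(_ x xS x) H _ _ _] := gP p.
  have [|_ /= fx] := H; first by rewrite /oball /= Dxx.
  apply: le_lt_trans (Dtri _ x _) _.
  by rewrite (Dsym x); move: xe fx; rewrite /oball /=; lra.
pose hits y e (p : 'I_K) := `[< oball D y e `&` S1 p !=set0 >].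
have mu'_hits y e : mu' (oball D y e) = \sum_(p | hits y e p) w p * nu p (oball D y e `&` S1 p).
  rewrite /mu' [RHS]big_mkcond; apply: eq_bigr => p _; case: ifPn => // /asboolPn.
  by move=> /set0P/negP/negPn/eqP ->; rewrite fin_content0// mulr0.
(* If [S1 p] meets the ball, then [f p] is within [e + r / 2] of [y], and the cell is within [r] of
   [f p]. *)
have sumV y e : 0 < e -> \sum_(p | hits y e p) mu (V p) <= mu (oball D y (e + 2 * r)).
  move=> e0; apply: fin_content_sum_le => //.
  - exact: index_enum_uniq.
  - by apply: measurable_oball; rewrite addr_gt0 ?mulr_gt0.
  - by move=> i j _ _; exact: cell_disjoint.
  - move=> p /asboolP /hit yp x [[_ fx] _]; rewrite /oball /=.
    by apply: le_lt_trans (Dtri _ (f p) _) _; move: fx; rewrite /oball/=; lra.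
exists mu', S', t, (\sum_p w p * M1 p); split; first split.
- split=> //.
  + exact: fin_content_combination.
  + by apply: fin_bigcup_measurable => //; exact: finite_finset.
  + by apply: sumr_ge0 => p _; rewrite mulr_ge0//; have [[]] := gP p.
- rewrite /mu' big1// => p _.
  rewrite (_ : _ `&` _ = set0) ?fin_content0 ?mulr0//.
  by apply/seteqP; split=> // x [nS xS]; apply: nS; exists p.
- move=> A mA; rewrite /mu' mulr_suml; apply: ler_sum => p _.
  rewrite nu_split// -mulrA ler_wpM2l//.
  by have [_ _ _ + _] := gP p; exact.
- move=> y e e0.
  have mo := measurable_oball y e0.
  have big : mu' (oball D y e) <= mu (oball D y (e + 2 * r)).
    rewrite mu'_hits; apply: le_trans (sumV y e e0).
    by apply: ler_sum => p _; exact: wnu.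
  have e2r : 0 < e + 2 * r by rewrite addr_gt0 ?mulr_gt0.
  have [ee|ee] := leP eta e.
    apply: le_trans big _; apply: le_trans (muF _ _ e2r) _.
    rewrite ler_pM2l//; apply: ge0_ler_powR => //; rewrite ?nnegrE ?mulr_ge0 ?(ltW lam0) ?(ltW lam'0) ?(ltW e0) ?(ltW e2r)//.
    have : 2 * lam * r <= (lam' - lam) * eta.
      move: rh; rewrite /h ler_pdivlMr; last by rewrite mulr_gt0.
      by rewrite mulrC.
    by nra.
  have [ee1 ee2] : e < eta1 /\ e < eta2 by move: ee; rewrite lt_min => /andP[].
  have muball z q : 0 < q -> mu (oball D z q) <= M * CQ * q `^ Q.
    move=> q0; apply: le_trans (muM _ (measurable_oball z q0)) _.
    by rewrite -mulrA ler_wpM2l// P_le.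
  have [er|er] := leP (r / 2) e.
    apply: le_trans big _.
    have e5 : 0 < 5 * e by rewrite mulr_gt0.
    apply: (@le_trans _ _ (mu (oball D y (5 * e)))).
      apply: fin_content_le => //; [exact: measurable_oball|exact: measurable_oball|].
      by move=> x; rewrite /oball /=; lra.
    apply: le_trans (muball _ _ e5) _.
    by rewrite (powRM _ (ler0n _ 5) (ltW e0)) mulrA; apply: He1.
  apply: le_trans (He2 _ e0 ee2).
  have r3 : 0 < 3 * r by rewrite mulr_gt0.
  rewrite mu'_hits.
  (* The cells that are hit have total mass at most [M * CQ * (3 * r) ^ Q]. Divided by the lower
     bound [cQ * (r / 2) ^ Q] this is free of [r], and the local measures contribute the factor
     [C' * e ^ s]. *)
  apply: (@le_trans _ _ (\sum_(p | hits y e p) mu (V p) / (cQ * (r / 2) `^ Q) * (C' * e `^ s))).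
    apply: ler_sum => p _; rewrite nu_split//.
    apply: ler_pM => //; first exact: fin_content_ge0.
      by rewrite ler_wpM2l// lef_pV2// posrE.
    by have [_ _ _ _] := gP p; exact.
  rewrite -mulr_suml -mulr_suml mulrA.
  rewrite ler_wpM2r ?powR_ge0// ler_wpM2r ?(ltW C'_gt0)//.
  apply: (@le_trans _ _ (M * CQ * (3 * r) `^ Q / (cQ * (r / 2) `^ Q))).
    rewrite ler_wpM2r ?invr_ge0 ?(ltW cr0)//.
    apply: le_trans (sumV y e e0) _; apply: le_trans (muball _ _ r3).
    apply: fin_content_le => //; [exact: measurable_oball|exact: measurable_oball|].
    by move=> x; rewrite /oball /=; lra.
  have -> : 3 * r = 6 * (r / 2) by field.
  have -> : (6 * (r / 2)) `^ Q = 6 `^ Q * (r / 2) `^ Q by rewrite powRM ?ltW.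
  have u0 := powR_gt0 Q r2.
  by rewrite le_eqVlt; apply/orP; left; apply/eqP; field; rewrite !gt_eqF.
- rewrite /mu'; under eq_bigr => p _.
    rewrite setTI -[S1 p]setTI nu_split// (_ : nu p setT = P (oball D (f p) (r / 2))); last first.
      by have [_ _ []] := gP p.
    rewrite /w divfK ?gt_eqF//; over.
  have [mU eU] := fin_content_sum muP (index_enum_uniq 'I_K) (Q := predT) mV
    (fun i j _ _ => @cell_disjoint S r _ f i j).
  rewrite -eU; set U := [set x | _].
  have -> : U = S.
    apply/seteqP; split=> x; first by move=> [i [_ _ [[]]]].
    by move=> /(cell_cover fcov) [i Vi]; exists i; split=> //; exact: mem_index_enum.
  by rewrite (fin_contentD muP measurableT mS)// setTD muS addr0.
- move=> y [p _ Sy] z yz; have [[_ _ tp _] /(_ y Sy z) H _ _ _] := gP p.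
  have [|Fz fz] := H; first exact: lt_le_trans yz (tt p).
  split=> //; exists (f p) => //; apply: lt_le_trans fz _; lra.
Qed.


(* Each step costs an enlargement of the radius; the enlargements stay bounded by [2]. *)
Let lam (n : nat) : R := 2 - n.+1%:R^-1.

Let lam_gt0 n : 0 < lam n.
Proof. by rewrite /lam subr_gt0 (@le_lt_trans _ _ 1) ?ltr1n// invf_le1// ler1n. Qed.

Let lam_lt n : lam n < lam n.+1.
Proof. by rewrite /lam ltrD2l ltrN2 ltf_pV2 ?posrE// ltr_nat. Qed.

Let lam_le2 n : lam n <= 2.
Proof. by rewrite /lam gerBl invr_ge0. Qed.

Lemma frostman_sequence mu0 S0 tau0 M0 : frostman mu0 S0 tau0 M0 1 ->
  exists (mu : nat -> set X -> R) (S : nat -> set X) (tau : nat -> R),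
  [/\ S 0%N = S0, tau 0%N = tau0,
      forall n, mu n setT = mu0 setT,
      forall n, exists M, frostman (mu n) (S n) (tau n) M 2 &
      forall n y, S n.+1 y -> oball D y (tau n.+1) `<=`
        F n `&` [set z | exists2 x, S n x & D x z < tau n / 2]].
Proof.
move=> h0; pose St : Type := ((set X -> R) * set X * R * R)%type.
pose good n (g : St) := frostman g.1.1.1 g.1.1.2 g.1.2 g.2 (lam n).
pose rel n (g g' : St) := [/\ good n.+1 g', g'.1.1.1 setT = g.1.1.1 setT &
  forall y, g'.1.1.2 y -> oball D y g'.1.2 `<=`
        F n `&` [set z | exists2 x, g.1.1.2 x & D x z < g.1.2 / 2]].
(* States that are not good are sent to themselves, so [next] is total and the recursion carries no
   proofs. *)
have /choice[next nextP] : forall ng : nat * St, exists g', good ng.1 ng.2 -> rel ng.1 ng.2 g'.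
  move=> [n g]; have [gn|ngn] := pselect (good n g); last by exists g.
  have [mu' [S' [t' [M' [h1 h2 h3]]]]] := frostman_step n (lam_gt0 n) (lam_lt n) gn.
  by exists (mu', S', t', M').
pose g := fix g n : St := if n is m.+1 then next (m, g m) else (mu0, S0, tau0, M0).
have gg n : good n (g n).
  elim: n => [|n IH]; first by rewrite /good /lam invr1 (_ : 2 - 1 = 1)//; lra.
  by have [] := nextP (n, g n) IH.
have rr n : rel n (g n) (g n.+1) by exact: nextP (n, g n) (gg n).
exists (fun n => (g n).1.1.1), (fun n => (g n).1.1.2), (fun n => (g n).1.2); split=> //.
- by elim=> // n <-; have [] := rr n.
- move=> n; exists (g n).2; have [h1 h2 h3 h4] := gg n; split=> // y e e0.
  apply: le_trans (h4 y e e0) _; rewrite ler_pM2l//.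
  apply: ge0_ler_powR => //; rewrite ?nnegrE ?mulr_ge0 ?(ltW e0) ?(ltW (lam_gt0 n))//.
  by rewrite ler_pM2r.
- by move=> n; have [] := rr n.
Qed.

(** [e0] is such that the balls take at most half of the common mass of the [mu n]. The points left
    over lie in the compact [K], and a subsequential limit remains in the nested neighbourhoods and
    outside the open balls. *)
Lemma cantor_avoids_cover (x0 : X) (R0 : R) (K : set X) : 0 < R0 ->
  dcompact D K -> oball D x0 R0 `<=` K ->
  exists2 e0 : R, 0 < e0 & forall (z : nat -> X) (r : nat -> R),
    (forall k, 0 < r k) -> (forall n, \sum_(k < n) r k `^ sigma <= e0) ->
    exists x, (forall n, F n x) /\ forall k, ~ oball D (z k) (r k) x.
Proof.
move=> R00 cK K0.
have R2 : 0 < R0 / 2 by rewrite divr_gt0.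
(* The other half of [R0] is the initial margin, which keeps the whole construction inside [K]. *)
pose S0 := oball D x0 (R0 / 2).
have mS0 : measurable S0 by exact: measurable_oball.
pose mu0 A := P (A `&` S0).
have mu0_le A : measurable A -> mu0 A <= P A.
  by move=> mA; apply: (fin_content_le P_content) => //; exact: measurableI.
have h0 : frostman mu0 S0 (R0 / 2) 1 1.
  split=> //.
  - split=> //; split=> [A mA|A B mA mB AB].
      by apply: (fin_content_ge0 P_content) => //; exact: measurableI.
    rewrite /mu0 setIUl P_content.2//; try exact: measurableI.
    by rewrite setIACA AB set0I.
  - by rewrite /mu0 setICl fin_content0.
  - by move=> A mA; rewrite mul1r; exact: mu0_le.
  move=> y e e0; rewrite mul1r; apply: le_trans (mu0_le _ (measurable_oball y e0)) _.
  rewrite /CF mulrDl; have [e1|/ltW e1] := leP e 1.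
    apply: (@le_trans _ _ (CQ * e `^ sigma)); last by rewrite lerDl mulr_ge0 ?powR_ge0.
    apply: le_trans (P_le y e0) _; rewrite ler_pM2l//.
    by apply: ger_powR; [rewrite e0|exact: ltW].
  apply: (@le_trans _ _ (P setT * e `^ sigma)); last first.
    by rewrite lerDr mulr_ge0 ?powR_ge0 ?ltW.
  apply: (@le_trans _ _ (P setT)).
    by apply: (fin_content_le P_content) => //; exact: measurable_oball.
  rewrite ler_peMr//; rewrite -(powRr0 e); exact: ler_powR.
have m0 : 0 < mu0 setT.
  rewrite /mu0 setTI.
  pose q := Num.min (R0 / 2) r0.
  have q0 : 0 < q by rewrite lt_min R2.
  apply: (@lt_le_trans _ _ (cQ * q `^ Q)); first by rewrite mulr_gt0// powR_gt0.
  apply: (@le_trans _ _ (P (oball D x0 q))); first by apply: P_ge => //; rewrite ge_min lexx orbT.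
  apply: (fin_content_le P_content) => //; first exact: measurable_oball.
  move=> x; rewrite /S0 /oball /=; have : q <= R0 / 2 by rewrite ge_min lexx.
  by lra.
have [mu [S [tau [S0E tau0E muT good nest]]]] := frostman_sequence h0.
pose c := CF * 2 `^ sigma.
have c0 : 0 < c by rewrite mulr_gt0// powR_gt0.
exists (mu0 setT / (2 * c)); first by rewrite divr_gt0// mulr_gt0.
move=> z r r_gt0 sum_r.
have tau_gt0 n : 0 < tau n by have [M [[]]] := good n.
have pick n : exists x, S n x /\ forall k : 'I_n, ~ oball D (z k) (r k) x.
  apply: contrapT => none; have [M [[muP mS _ _] muS _ muF]] := good n.
  have : mu n (S n) <= \sum_(k <- index_enum 'I_n) mu n (oball D (z k) (r k)).
    apply: (fin_content_bigU muP (Q := predT)) => //.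
      by move=> k; exact: measurable_oball.
    move=> x Sx; apply: contrapT => hx; apply: none; exists x; split=> // k zk; apply: hx.
    by exists k; split=> //; exact: mem_index_enum.
  have -> : mu n (S n) = mu0 setT.
    by rewrite -(muT n) (fin_contentD muP measurableT mS)// setTD muS addr0.
  apply/negP; rewrite -ltNge.
  apply: (@le_lt_trans _ _ (c * \sum_(k < n) r k `^ sigma)).
    rewrite mulr_sumr; apply: ler_sum => k _; apply: le_trans (muF _ _ (r_gt0 k)) _.
    by rewrite /c -mulrA powRM// ltW.
  apply: (@le_lt_trans _ _ (c * (mu0 setT / (2 * c)))); first by rewrite ler_pM2l.
  have -> : c * (mu0 setT / (2 * c)) = mu0 setT / 2 by field; rewrite gt_eqF.
  by lra.
have /choice[x xP] := pick.
(* [N n.+1] lies in the [tau n / 2]-neighbourhood of [S n]; the other half of [tau n] absorbs the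
   passage to the limit. *)
pose N n := [set y | exists2 p, S n p & D p y < tau n].
have nestN n : N n.+1 `<=` F n `&` [set y | exists2 p, S n p & D p y < tau n / 2].
  by move=> y [p Sp py]; exact: (nest n p Sp).
have half n : [set y | exists2 p, S n p & D p y < tau n / 2] `<=` N n.
  move=> y [p Sp py]; exists p => //; apply: lt_trans py _.
  by have := tau_gt0 n; lra.
have xN m : N m (x m).
  by exists (x m); [exact: (xP m).1|rewrite Dxx].
have nestm n k : N (n + k)%N `<=` N n.
  elim: k => [|k IH]; first by rewrite addn0.
  by rewrite addnS => y /nestN [_ /half /IH].
have xin n m : (n < m)%N -> exists2 p, S n p & D p (x m) < tau n / 2.
  move=> nm; have := xN m; rewrite -(subnKC nm) => /nestm /nestN [_].
  by rewrite (subnKC nm).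
have xK n : K (x n).
  apply: K0; have /(nestm 0%N) := xN n; rewrite /N /= S0E tau0E => -[p pS ph].
  rewrite /oball /=; apply: le_lt_trans (Dtri _ p _) _.
  by move: pS ph; rewrite /S0 /oball /=; lra.
have [phi [phi_mono [y Ky cvy]]] := cK x xK.
have phi_ge k : (k <= phi k)%N.
  by elim: k => // k IH; apply: leq_ltn_trans IH _; exact: phi_mono.
have close n e : 0 < e -> exists2 m, (n < m)%N & D (x m) y < e.
  move=> e0; move/cvgrPdist_lt: cvy => /(_ _ e0) [k _ kP].
  exists (phi (maxn k n.+1)).
    by apply: leq_trans (phi_ge _); rewrite leq_max leqnn orbT.
  have := kP (maxn k n.+1); rewrite /= leq_max leqnn => /(_ isT).
  by rewrite sub0r normrN; apply: le_lt_trans; exact: ler_norm.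
exists y; split=> [n|k].
  suff /nestN [] : N n.+1 y by [].
  have t2 : 0 < tau n.+1 / 2 by rewrite divr_gt0.
  have [m nm my] := close n.+1 _ t2; have [p Sp pm] := xin _ _ nm.
  by exists p => //; apply: le_lt_trans (Dtri _ (x m) _) _; lra.
rewrite /oball /= => zy.
(* If [y] were in ball [k], so would be some [x m] with [m > k], against the choice of [x m]. *)
have [|m km ym] := close k (r k - D (z k) y); first by rewrite subr_gt0.
apply: ((xP m).2 (Ordinal km)); rewrite /oball /=.
by apply: le_lt_trans (Dtri _ y _) _; rewrite (Dsym y); lra.
Qed.

End Cantor.

(** * Estimates in one coordinate *)

Section MetricFacts.
Context {R : realType} {T : Type}.
Variable D : T -> T -> R.

(** A strict bound on the infimum produces a witness; an empty [E] has distance [+oo] and falsifies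
    both sides. *)
Lemma DeltaP (E : set T) (eps : R) y : Delta D E eps y <-> exists2 e, E e & D y e < eps.
Proof.
rewrite /Delta /dist_set /=; split.
  by move=> /ereal_inf_lt [_ [e Ee <-]]; rewrite lte_fin; exists e.
move=> [e Ee ye]; apply: (@le_lt_trans _ _ (D y e)%:E); last by rewrite lte_fin.
by apply: ereal_inf_lbound; exists e.
Qed.

Hypothesis D_metric : is_metric D.

Lemma dopen_oball x r : dopen D (oball D x r).
Proof.
move=> y; rewrite /oball /= => xy; exists (r - D x y); first by rewrite subr_gt0.
case: D_metric => _ _ _ tri z /= yz.
by apply: le_lt_trans (tri _ y _) _; lra.
Qed.

Lemma dopen_Delta E eps : dopen D (Delta D E eps).
Proof.
move=> y /DeltaP [e Ee ye]; exists (eps - D y e); first by rewrite subr_gt0.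
case: D_metric => _ _ sym tri z; rewrite /oball /= => yz.
apply/DeltaP; exists e => //.
by apply: le_lt_trans (tri _ y _) _; rewrite sym; lra.
Qed.

End MetricFacts.

Section CoordinateEstimate.
Context {R : realType} {disp : measure_display} {T : measurableType disp}.
Variables (D : T -> T -> R) (pr : set T -> R) (delta kappa C c2 c3 r0 : R).
Hypothesis D_metric : is_metric D.
Hypothesis T_borel : @measurable _ T = <<s dopen D >>.
Hypothesis prP : fin_content pr.
Hypothesis kappa01 : 0 <= kappa < 1.
Hypothesis delta_gt0 : 0 < delta.
Hypothesis C_gt0 : 0 < C.
Hypothesis c2_gt0 : 0 < c2.
Hypothesis c3_gt0 : 0 < c3.
Hypothesis pr_le : forall x r, 0 < r -> r <= r0 -> pr (oball D x r) <= C * r `^ delta.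

Definition kappa_scaling (E : set T) := forall x eps r, E x -> 0 < eps -> eps < r -> r <= r0 ->
  c2 * r `^ (delta * kappa) * eps `^ (delta * (1 - kappa))
    <= pr (oball D x r `&` Delta D E eps)
    <= c3 * r `^ (delta * kappa) * eps `^ (delta * (1 - kappa)).

Lemma borel_oball x r : measurable (oball D x r).
Proof. by rewrite T_borel; apply: sub_sigma_algebra; exact: dopen_oball. Qed.

Lemma borel_Delta E eps : measurable (Delta D E eps).
Proof. by rewrite T_borel; apply: sub_sigma_algebra; exact: dopen_Delta. Qed.

(** Dominates the constants of the three ranges of [A] in [coordinate_estimate]. *)
Definition coord_cst : R := 1 + c3 * 3 `^ (delta * kappa) / c2 + C / c2.

Let oball3 w x z v (e ep : R) : D z w < e -> D x z < ep -> D x v < ep -> e <= ep ->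
  D w v < 3 * ep.
Proof.
case: D_metric => _ _ sym tri zw xz xv ee.
apply: le_lt_trans (tri _ x _) _; apply: le_lt_trans (lerD (tri _ z _) (lexx _)) _.
by rewrite (sym w z) (sym z x); lra.
Qed.

(* In the three ranges of [A] the intersection is estimated trivially, by the
   scaling property and by Ahlfors regularity, respectively. *)
Lemma coordinate_estimate (E : set T) (x y : T) (h a t A : R) :
  kappa_scaling E -> E y -> 0 < h < 1 -> 0 < t -> 
  h `^ a <= r0 -> 3 * h `^ A <= r0 ->
  Num.max (h `^ A) (h `^ a) `^ delta *
    pr (oball D x (h `^ A) `&` (oball D y (h `^ a) `&` Delta D E (h `^ (a + t))))
  <= coord_cst * h `^ (delta * (A - (1 - kappa) * clamp a t A)) *
     pr (oball D y (h `^ a) `&` Delta D E (h `^ (a + t))).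
Proof.
move=> Hs Ey /andP[h0 h1] t0 br0 er0; case/andP: kappa01 => kap0 kap1.
case: (D_metric) => _ _ sym tri.
have k1 : 0 <= c3 * 3 `^ (delta * kappa) / c2.
  by rewrite divr_ge0 ?mulr_ge0 ?powR_ge0 ?ltW.
have k2 : 0 <= C / c2 by rewrite divr_ge0 ?ltW.
have [K1 K2 K3] : [/\ 1 <= coord_cst, c3 * 3 `^ (delta * kappa) / c2 <= coord_cst &
    C / c2 <= coord_cst] by rewrite /coord_cst; split; lra.
have pw z : 0 < h `^ z by exact: powR_gt0.
have h01 : 0 < h <= 1 by rewrite h0 ltW.
have mono u v : u <= v -> h `^ v <= h `^ u by exact: ger_powR.
have powD u v : h `^ u * h `^ v = h `^ (u + v) by rewrite powRD// (gt_eqF h0) implybT.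
set b := h `^ a; set e := h `^ (a + t); set ep := h `^ A.
have mS : measurable (oball D y b `&` Delta D E e).
  by apply: measurableI; [exact: borel_oball|exact: borel_Delta].
have mB : measurable (oball D x ep) by exact: borel_oball.
have mI : measurable (oball D x ep `&` (oball D y b `&` Delta D E e)) by exact: measurableI.
have eb : e < b.
  rewrite /e /b -powD gtr_pMr//.
  by rewrite -ltr_ln ?posrE// ln_powR ln1 pmulr_rlt0// ln_lt0// h0.
have [Slo _] := andP (Hs y e b Ey (pw _) eb br0).
set pS := pr (oball D y b `&` Delta D E e) in Slo *.
have pS0 : 0 <= pS by exact: fin_content_ge0.
have Kle z w (Z : R) : 0 <= w -> 0 <= Z -> z <= coord_cst -> z * w * Z <= coord_cst * w * Z.
  by move=> w0 Z0 zk; rewrite ler_wpM2r// ler_wpM2r.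
case: (clampP a A (ltW t0)) => -[hA ->].
- have be : b <= ep by exact: mono.
  rewrite max_l// mulr0 subr0.
  apply: (@le_trans _ _ (1 * h `^ (delta * A) * pS)); last first.
    by apply: Kle; [exact: powR_ge0|by []|].
  rewrite mul1r -powRrM mulrC [A * delta]mulrC mulrC ler_pM2l//.
  by apply: fin_content_le => // z [].
- have [be ee] : ep <= b /\ e <= ep by case: hA => ? ?; split; exact: mono.
  rewrite max_r//.
  apply: (@le_trans _ _ (c3 * 3 `^ (delta * kappa) / c2 *
     h `^ (delta * (A - (1 - kappa) * (A - a))) * pS)); last first.
    by apply: Kle; [exact: powR_ge0|by []|].
  (* The scaling property holds for centres in [E]. A point of the intersection supplies such a
     centre [w], at the price of tripling the radius. *)
  have [emp|] := eqVneq (oball D x ep `&` (oball D y b `&` Delta D E e)) set0.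
    by rewrite emp fin_content0// mulr0; exact: mulr_ge0 (mulr_ge0 k1 (powR_ge0 _ _)) pS0.
  move=> /set0P [z [xz [_ /DeltaP [w Ew zw]]]].
  have e3 : e < 3 * ep by rewrite (le_lt_trans ee)// (ltr_pMl _ (pw A)) ltr1n.
  have [_ hi] := andP (Hs w e (3 * ep) Ew (pw _) e3 er0).
  have up : pr (oball D x ep `&` (oball D y b `&` Delta D E e)) <=
      c3 * (3 * ep) `^ (delta * kappa) * e `^ (delta * (1 - kappa)).
    apply: le_trans hi; apply: fin_content_le => //.
      by apply: measurableI; [exact: borel_oball|exact: borel_Delta].
    move=> v [xv [_ Ev]]; split=> //; rewrite /oball /=.
    exact: oball3 zw xz xv ee.
  apply: (@le_trans _ _ (b `^ delta * (c3 * (3 * ep) `^ (delta * kappa) * e `^ (delta * (1 - kappa))))).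
    by rewrite ler_wpM2l ?powR_ge0.
  apply: (@le_trans _ _ (c3 * 3 `^ (delta * kappa) / c2 *
     h `^ (delta * (A - (1 - kappa) * (A - a))) *
     (c2 * b `^ (delta * kappa) * e `^ (delta * (1 - kappa))))); last first.
    by apply: ler_wpM2l => //; rewrite mulr_ge0 ?powR_ge0.
  rewrite (powRM _ (ler0n _ 3) (ltW (pw _))) /b /ep /e -!powRrM.
  have -> (X Y Z : R) : X * (c3 * (3 `^ (delta * kappa) * Y) * Z) =
     c3 * 3 `^ (delta * kappa) * (X * Y * Z) by ring.
  have -> (X Y Z : R) : c3 * 3 `^ (delta * kappa) / c2 * X * (c2 * Y * Z) =
     c3 * 3 `^ (delta * kappa) * (X * Y * Z).
    by field; rewrite gt_eqF.
  rewrite !powD le_eqVlt; apply/orP; left; apply/eqP; congr (_ * h `^ _); ring.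
- have ee : ep <= e by exact: mono.
  rewrite max_r; last by rewrite (le_trans ee)// ltW.
  apply: (@le_trans _ _ (C / c2 * h `^ (delta * (A - (1 - kappa) * t)) * pS)); last first.
    by apply: Kle; [exact: powR_ge0|by []|].
  have ep0 : 0 < ep := pw A.
  apply: (@le_trans _ _ (b `^ delta * (C * ep `^ delta))).
    rewrite ler_wpM2l ?powR_ge0//.
    have epr : ep <= r0 by apply: le_trans er0; rewrite (ler_peMl (ltW ep0)) ?ler1n.
    by apply: le_trans (pr_le x ep0 epr); apply: fin_content_le => // v [].
  apply: (@le_trans _ _ (C / c2 * h `^ (delta * (A - (1 - kappa) * t)) *
     (c2 * b `^ (delta * kappa) * e `^ (delta * (1 - kappa))))); last first.
    by apply: ler_wpM2l => //; rewrite mulr_ge0 ?powR_ge0.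
  rewrite /b /ep /e -!powRrM.
  have -> (X Y : R) : X * (C * Y) = C * (X * Y) by ring.
  have -> (X Y Z : R) : C / c2 * X * (c2 * Y * Z) = C * (X * Y * Z).
    by field; rewrite gt_eqF.
  rewrite !powD le_eqVlt; apply/orP; left; apply/eqP; congr (_ * h `^ _); ring.
Qed.

End CoordinateEstimate.

(** * The product space *)

Section ProductSpace.
Context {R : realType} {d : nat} {dT : 'I_d -> measure_display}.
Context {T : forall i : 'I_d, measurableType (dT i)}.
Variables (dist : forall i : 'I_d, T i -> T i -> R).
Variables (m : forall i : 'I_d, probability (T i) R).
Variable mX : {measure set (Xsig T) -> \bar R}.
Arguments dist : clear implicits.
Arguments m : clear implicits.
Hypothesis dist_metric : forall i, is_metric (dist i).
Hypothesis dist_borel : forall i, @measurable _ (T i) = <<s dopen (dist i) >>.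
Hypothesis mX_prod : forall B : forall i, set (T i), (forall i, measurable (B i)) ->
  mX [set x : Xsig T | forall i, B i (x i)] = (\prod_(i < d) m i (B i))%E.

Local Notation X := (Xsig T).

Definition rect (B : forall i, set (T i)) : set X := [set x : X | forall i, B i (x i)].

Lemma measurable_rect (B : forall i, set (T i)) :
  (forall i, measurable (B i)) -> measurable (rect B).
Proof. by move=> mB; apply: sub_sigma_algebra; exists B. Qed.

Definition coord_content i (A : set (T i)) : R := fine (m i A).
Definition prod_content (A : set X) : R := fine (mX A).

Lemma coord_contentE i (A : set (T i)) : measurable A -> m i A = (coord_content A)%:E.
Proof. by move=> mA; rewrite fineK// fin_num_measure. Qed.

Lemma coord_content_fin i : fin_content (@coord_content i).
Proof.
split=> [A mA|A B mA mB AB]; first exact: fine_ge0.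
by rewrite /coord_content measureU// fineD// fin_num_measure.
Qed.

Lemma mX_setT : mX setT = 1%E.
Proof.
have := mX_prod (fun i => @measurableT _ (T i)).
rewrite big1; last by move=> i _; exact: probability_setT.
by move=> <-; congr (mX _); apply/seteqP; split.
Qed.

Lemma mX_fin (A : set X) : measurable A -> mX A \is a fin_num.
Proof.
move=> mA; rewrite ge0_fin_numE//; apply: (@le_lt_trans _ _ 1%E); last exact: ltry.
by rewrite -mX_setT; apply: le_measure; rewrite ?inE//; exact: measurableT.
Qed.

Lemma prod_contentE (A : set X) : measurable A -> mX A = (prod_content A)%:E.
Proof. by move=> mA; rewrite fineK// mX_fin. Qed.

Lemma prod_content_fin : fin_content prod_content.
Proof.
split=> [A mA|A B mA mB AB]; first exact: fine_ge0.
by rewrite /prod_content measureU// fineD// mX_fin.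
Qed.

Lemma prod_content_rect (B : forall i, set (T i)) : (forall i, measurable (B i)) ->
  prod_content (rect B) = \prod_(i < d) coord_content (B i).
Proof.
move=> mB; rewrite /prod_content /rect mX_prod//.
under eq_bigr do rewrite coord_contentE//.
by rewrite prodEFin.
Qed.

Lemma prod_content_setT : prod_content setT = 1.
Proof. by rewrite /prod_content mX_setT. Qed.

Lemma oball_distX (x : X) r : 0 < r -> oball (distX dist) x r = rect (fun i => oball (dist i) (x i) r).
Proof.
move=> r0; apply/seteqP; split=> y; rewrite /oball /rect /distX /=.
  by move=> /bigmax_ltP [_ h] i; exact: h.
by move=> h; apply/bigmax_ltP; split.
Qed.

Lemma dist_le_distX (x y : X) i : dist i (x i) (y i) <= distX dist x y.
Proof. exact: le_bigmax. Qed.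

Lemma distX_lt (x y : X) r : 0 < r -> (forall i, dist i (x i) (y i) < r) -> distX dist x y < r.
Proof. by move=> r0 h; apply/bigmax_ltP; split. Qed.

Lemma distX_metric : is_metric (distX dist : X -> X -> R).
Proof.
have d0 i : forall x y, 0 <= dist i x y by case: (dist_metric i).
split.
- by move=> x y; exact: bigmax_ge_id.
- move=> x y; split=> [h|->].
    apply: functional_extensionality_dep => i.
    have /= := dist_le_distX x y i; rewrite h => hi.
    case: (dist_metric i) => _ /(_ (x i) (y i)) [+ _] _ _; apply.
    by apply/eqP; rewrite eq_le hi d0.
  apply/eqP; rewrite eq_le bigmax_ge_id andbT; apply/bigmax_leP; split=> // i _.
  by case: (dist_metric i) => _ /(_ (y i) (y i)) [_ ->].
- by move=> x y; apply: eq_bigr => i _; case: (dist_metric i).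
- move=> x y z; apply/bigmax_leP; split=> [|i _].
    by rewrite addr_ge0// bigmax_ge_id.
  case: (dist_metric i) => _ _ _ /(_ (x i) (y i) (z i)) h; apply: le_trans h _.
  by apply: lerD; exact: dist_le_distX.
Qed.

Lemma measurable_oball_distX (x : X) r : 0 < r -> measurable (oball (distX dist : X -> X -> R) x r).
Proof.
move=> r0; rewrite oball_distX//; apply: measurable_rect => i.
exact: borel_oball.
Qed.

(** Subsequences are extracted one coordinate at a time, by induction on a list of coordinates;
    refining preserves the limits already obtained. *)
Lemma dcompact_rect (K : forall i, set (T i)) :
  (forall i, dcompact (dist i) (K i)) -> dcompact (distX dist : X -> X -> R) (rect K).
Proof.
move=> cK v vK.
have H (l : seq 'I_d) : exists phi : nat -> nat, {homo phi : n m / (n < m)%N} /\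
    forall i, i \in l -> exists2 y, K i y &
      (fun n => dist i (v (phi n) i) y) @ \oo --> (0 : R).
  elim: l => [|i l [phi [mphi hphi]]]; first by exists id; split=> // i; rewrite in_nil.
  have [psi [mpsi [y Ky cy]]] := cK i (fun n => v (phi n) i) (fun n => vK (phi n) i).
  exists (phi \o psi); split; first by move=> n n' nn; apply: mphi; exact: mpsi.
  move=> j; rewrite inE => /orP[/eqP ->|jl]; first by exists y.
  have [z Kz cz] := hphi j jl; exists z => //.
  have psi_oo : psi n @[n --> \oo] --> \oo.
    have ge n : (n <= psi n)%N.
      by elim: n => // n IH; apply: leq_ltn_trans IH _; apply: mpsi.
    apply/cvgnyPge => A; near=> n; apply: leq_trans (ge n); near: n.
    exact: nbhs_infty_ge.
  exact: (@cvg_comp _ _ _ psi (fun n => dist j (v (phi n) j) z) _ _ _ psi_oo cz).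
have [phi [mphi hphi]] := H (enum 'I_d).
have Y i : {y | K i y & (fun n => dist i (v (phi n) i) y) @ \oo --> (0 : R)}.
  by apply: cid2; apply: hphi; rewrite mem_enum.
pose y : X := fun i => s2val (Y i).
exists phi; split=> //; exists y; first by move=> i; exact: (s2valP (Y i)).
apply/cvgrPdist_lt => e e0.
have : \forall n \near \oo, forall i, dist i (v (phi n) i) (y i) < e.
  apply: filter_forall => i.
  have := s2valP' (Y i); rewrite -/(y i) => /cvgrPdist_lt /(_ e e0).
  apply: filterS => n; rewrite sub0r normrN; apply: le_lt_trans; exact: ler_norm.
apply: filterS => n h; rewrite sub0r normrN ger0_norm; last by case: distX_metric.
exact: distX_lt.
Unshelve. all: by end_near.
Qed.

End ProductSpace.

(** * Local measures from ubiquity *)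

Section LocalMeasure.
Context {R : realType} {d : nat} {dT : 'I_d -> measure_display}.
Context {T : forall i : 'I_d, measurableType (dT i)} {J : Type}.
Variables (dist : forall i : 'I_d, T i -> T i -> R).
Variables (m : forall i : 'I_d, probability (T i) R).
Variable mX : {measure set (Xsig T) -> \bar R}.
Variables (delta a t c C c2 c3 : 'I_d -> R) (kappa r0 cu s : R).
Variables (Rset : J -> forall i : 'I_d, set (T i)) (JN : nat -> set J).
Variables (h : nat -> R) (v : nat -> 'I_d -> R).
Arguments dist : clear implicits.
Arguments m : clear implicits.
Arguments Rset : clear implicits.
Hypothesis dist_metric : forall i, is_metric (dist i).
Hypothesis dist_borel : forall i, @measurable _ (T i) = <<s dopen (dist i) >>.
Hypothesis mX_prod : forall B : forall i, set (T i), (forall i, measurable (B i)) ->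
  mX [set x : Xsig T | forall i, B i (x i)] = (\prod_(i < d) m i (B i))%E.

Local Notation X := (Xsig T).
Local Notation p i := (@coord_content R d dT T m i).
Local Notation P := (prod_content mX).

Hypothesis a_gt0 : forall i, 0 < a i.
Hypothesis t_gt0 : forall i, 0 < t i.
Hypothesis c_gt0 : forall i, 0 < c i.
Hypothesis C_gt0 : forall i, 0 < C i.
Hypothesis c2_gt0 : forall i, 0 < c2 i.
Hypothesis c3_gt0 : forall i, 0 < c3 i.
Hypothesis cu_gt0 : 0 < cu.
Hypothesis kappa01 : 0 <= kappa < 1.
Hypothesis p_ge : forall i x r, 0 < r -> r <= r0 -> c i * r `^ delta i <= p i (oball (dist i) x r).
Hypothesis p_le : forall i x r, 0 < r -> r <= r0 -> p i (oball (dist i) x r) <= C i * r `^ delta i.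
Hypothesis scaling : forall i alpha,
  kappa_scaling (dist i) (p i) (delta i) kappa (c2 i) (c3 i) r0 (Rset alpha i).
Hypothesis JN_finite : forall n, finite_set (JN n).
Hypothesis ubiquity : forall (x : X) r, 0 < r -> exists n0 : nat, forall n, (n0 <= n)%N ->
  cu * P (rect (fun i => oball (dist i) (x i) r)) <=
  P (rect (fun i => oball (dist i) (x i) r) `&`
     \bigcup_(alpha in JN n) rect (fun i => Delta (dist i) (Rset alpha i) (h n `^ a i))).
Hypothesis good_scales : forall h0 n0, 0 < h0 -> exists2 N, (n0 <= N)%N &
  0 < h N < h0 /\ forall i, 2 * h N `^ t i <= v N i.
Hypothesis s_exponent : forall A, 0 < A -> s * A <= exponent delta a kappa t A.

(** The radii are frozen at scale [N] instead of following [alpha]; [tail_union_limsup] compensates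
    by monotonicity. *)
Definition tail_union (n : nat) : set X :=
  [set x | exists2 N, (n <= N)%N & exists2 alpha, JN N alpha &
    forall i, Delta (dist i) (Rset alpha i) (h N `^ a i * v N i) (x i)].

(** The factors [C i] enter through the mass of the ball, the covering that bounds [K] below and the
    count of boxes hit; the powers of [4] come from that count, those of [2] from halving [r] and
    doubling the boxes. *)
Definition local_cst : R :=
  (\prod_i coord_cst (delta i) kappa (C i) (c2 i) (c3 i)) * (\prod_i C i) ^+ 3 *
  (\prod_i 4 `^ delta i) * (\prod_i 2 `^ delta i) ^+ 2 / (cu * (\prod_i c i) ^+ 2).

Let k i := coord_cst (delta i) kappa (C i) (c2 i) (c3 i).

Let k_gt0 i : 0 < k i.
Proof.
have h1 : 0 <= c3 i * 3 `^ (delta i * kappa) / c2 i.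
  by rewrite divr_ge0 ?mulr_ge0 ?powR_ge0 ?ltW.
have h2 : 0 <= C i / c2 i by rewrite divr_ge0 ?ltW.
rewrite /k /coord_cst; lra.
Qed.

Lemma local_cst_gt0 : 0 < local_cst.
Proof.
have pp (f : 'I_d -> R) : (forall i, 0 < f i) -> 0 < \prod_i f i by move=> ?; exact: prodr_gt0.
by rewrite /local_cst divr_gt0 ?mulr_gt0 ?exprn_gt0 ?pp// => i; exact: powR_gt0.
Qed.

Let measurable_oball i x r : measurable (oball (dist i) x r).
Proof. exact: borel_oball. Qed.

Let measurable_Delta i E r : measurable (Delta (dist i) E r).
Proof. exact: borel_Delta. Qed.

Let measurable_rect_oball (x : X) (r : 'I_d -> R) :
  measurable (rect (fun i => oball (dist i) (x i) (r i))).
Proof. exact: measurable_rect. Qed.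

Let Pfin : fin_content P. Proof. exact: (prod_content_fin mX_prod). Qed.

Let dsym i x y : dist i x y = dist i y x. Proof. by case: (dist_metric i). Qed.
Let dtri i x y z : dist i x z <= dist i x y + dist i y z. Proof. by case: (dist_metric i). Qed.

Lemma P_rect_ge (x : X) (r : 'I_d -> R) : (forall i, 0 < r i <= r0) ->
  \prod_i c i * \prod_i r i `^ delta i <= P (rect (fun i => oball (dist i) (x i) (r i))).
Proof.
move=> hr; rewrite (prod_content_rect mX_prod)// -big_split /=.
apply: ler_prod => i _; have /andP[h1 h2] := hr i.
by rewrite (mulr_ge0 (ltW (c_gt0 i)) (powR_ge0 _ _)) p_ge.
Qed.

Lemma P_rect_le (x : X) (r : 'I_d -> R) : (forall i, 0 < r i <= r0) ->
  P (rect (fun i => oball (dist i) (x i) (r i))) <= \prod_i C i * \prod_i r i `^ delta i.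
Proof.
move=> hr; rewrite (prod_content_rect mX_prod)// -big_split /=.
apply: ler_prod => i _; have /andP[h1 h2] := hr i.
by rewrite p_le// andbT; exact: (fin_content_ge0 (coord_content_fin m i)).
Qed.

Let prod_scale (q : R) (r : 'I_d -> R) : 0 <= q -> (forall i, 0 < r i) ->
  \prod_i (q * r i) `^ delta i = \prod_i q `^ delta i * \prod_i r i `^ delta i.
Proof.
move=> q0 hr; rewrite -big_split /=; apply: eq_bigr => i _.
by rewrite powRM// ltW.
Qed.

Let prod_pow_gt0 (r : 'I_d -> R) : (forall i, 0 < r i) -> 0 < \prod_i r i `^ delta i.
Proof. by move=> hr; apply: prodr_gt0 => i _; exact: powR_gt0. Qed.

Lemma separated_disjoint (S : set X) (b : 'I_d -> R) K (f : 'I_K -> X) i j :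
  separated_family (fun x y => forall i, dist i (x i) (y i) < 2 * b i) S f -> i != j ->
  rect (fun l => oball (dist l) (f i l) (b l)) `&`
  rect (fun l => oball (dist l) (f j l) (b l)) = set0.
Proof.
move=> [_ fsep] ij; apply/seteqP; split=> // x [h1 h2]; apply: (fsep i j ij) => l.
have := h1 l; have := h2 l; rewrite /oball /= => g1 g2.
by apply: le_lt_trans (dtri _ (x l) _) _; rewrite (dsym (x l)); lra.
Qed.

(** Volume comparison: the disjoint boxes of half-sides [b] all fit in the box of half-sides [q]. *)
Lemma separated_count (S : set X) (b : 'I_d -> R) K (f : 'I_K -> X) (H : pred 'I_K)
    (y : X) (q : 'I_d -> R) :
  separated_family (fun x y => forall i, dist i (x i) (y i) < 2 * b i) S f ->
  (forall i, 0 < b i <= r0) -> (forall i, 0 < q i <= r0) ->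
  (forall j, H j -> forall i, dist i (y i) (f j i) + b i <= q i) ->
  #|H|%:R * (\prod_i c i * \prod_i b i `^ delta i) <= \prod_i C i * \prod_i q i `^ delta i.
Proof.
move=> fsep hb hq hH; apply: le_trans (P_rect_le y hq).
apply: le_trans (fin_content_sum_le Pfin (index_enum_uniq 'I_K) (Q := H)
   (F := fun j => rect (fun i => oball (dist i) (f j i) (b i))) _ _ _ _) => //.
- have -> : #|H|%:R * (\prod_i c i * \prod_i b i `^ delta i) =
    \sum_(j | H j) (\prod_i c i * \prod_i b i `^ delta i).
    by rewrite sumr_const mulr_natl.
  by apply: ler_sum => j _; exact: P_rect_ge.
- by move=> i j _ _; exact: separated_disjoint fsep.
- move=> j Hj x hx i; have := hx i; have := hH j Hj i; rewrite /oball /= => g1 g2.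
  by apply: le_lt_trans (dtri _ (f j i) _) _; lra.
Qed.

Lemma separated_net (S : set X) (b : 'I_d -> R) : (forall i, 0 < b i <= r0) ->
  exists K (f : 'I_K -> X),
    separated_family (fun x y => forall i, dist i (x i) (y i) < 2 * b i) S f /\
    forall x, S x -> exists j, forall i, dist i (f j i) (x i) < 2 * b i.
Proof.
move=> hb; pose e := \prod_i c i * \prod_i b i `^ delta i.
have e0 : 0 < e.
  apply: mulr_gt0; first exact: prodr_gt0.
  by apply: prod_pow_gt0 => i; have /andP[] := hb i.
apply: (@maximal_separated_family _ _ S (Num.trunc e^-1).+1).
  by move=> x y hxy i; rewrite dsym.
move=> K f fsep.
have : K%:R * e <= P setT.
  apply: le_trans (fin_content_sum_le Pfin (index_enum_uniq 'I_K) (Q := predT)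
   (F := fun j => rect (fun i => oball (dist i) (f j i) (b i))) _ _ _ _) => //.
  - have -> : K%:R * e = \sum_(j < K) e by rewrite sumr_const card_ord mulr_natl.
    by apply: ler_sum => j _; exact: P_rect_ge.
  - by move=> i j _ _; exact: separated_disjoint fsep.
rewrite (prod_content_setT mX_prod) -ler_pdivlMr// mul1r => hK.
by rewrite -(ler_nat R); apply: le_trans hK _; apply/ltW; exact: truncnS_gt.
Qed.


Lemma powR_lt_of_lt (x y z : R) : 0 < x -> 0 < y -> 0 < z -> x < y `^ z^-1 -> x `^ z < y.
Proof.
move=> x0 y0 z0 xy; have -> : y = (y `^ z^-1) `^ z.
  by rewrite -powRrM mulVf ?gt_eqF// powRr1 ?ltW.
by apply: gt0_ltr_powR; rewrite ?nnegrE ?powR_ge0 ?ltW.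
Qed.

Lemma small_good_scale (r : R) n0 : 0 < r -> exists2 N, (n0 <= N)%N &
  [/\ 0 < h N < 1, forall i, h N `^ a i < r & forall i, 2 * h N `^ t i <= v N i].
Proof.
move=> r_gt0.
have [q q0 qi] : exists2 q, 0 < q & forall i : 'I_d, q <= r `^ (a i)^-1.
  by apply: bigmin_gt0 => i; exact: powR_gt0.
have [|N nN [/andP[hN hNq] hv]] := @good_scales (Num.min 1 q) n0.
  by rewrite lt_min ltr01.
move: hNq; rewrite lt_min => /andP[h1 hq].
exists N => //; split=> //; first by rewrite hN.
by move=> i; apply: powR_lt_of_lt => //; exact: lt_le_trans (qi i).
Qed.

(** Radii below [r0 / 4] keep the fourfold enlarged boxes within reach of the regularity bounds, and
    radii at most [1] make the exponent [A] of a smaller radius positive. *)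
Lemma local_measure_exists n (x : X) r : 0 < r -> r <= Num.min (r0 / 4) 1 ->
  exists nu S tau M,
    local_measure (distX dist : X -> X -> R) P tail_union s local_cst n x r nu S tau M.
Proof.
move=> r_gt0; rewrite le_min => /andP[rr0 rr1].
(* The points of the net lie within [r / 2] of [x]; three further displacements of at most [r / 8]
   stay inside the ball of radius [r]. *)
have [n0 ubi] := @ubiquity x (r / 2) (divr_gt0 r_gt0 (ltr0n _ 2)).
have r8_gt0 : 0 < r / 8 by rewrite divr_gt0.
have [N] := small_good_scale (maxn n n0) r8_gt0.
rewrite geq_max => /andP[nN n0N] [/andP[hN0 hN1] hb hv].
have {}ubi := ubi _ n0N.
set G := _ `&` _ in ubi.
pose b i := h N `^ a i; pose e i := h N `^ (a i + t i).
have b_gt0 i : 0 < b i by exact: powR_gt0.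
have e_gt0 i : 0 < e i by exact: powR_gt0.
have b_r8 i : b i <= r / 8 := ltW (hb i).
have b_r0 i : 0 < b i <= r0 by rewrite b_gt0 /=; have := b_r8 i; lra.
have eb i : e i < b i.
  rewrite /e /b powRD ?(gt_eqF hN0) ?implybT// gtr_pMr ?powR_gt0//.
  by rewrite -ltr_ln ?posrE ?powR_gt0// ln_powR ln1 pmulr_rlt0// ln_lt0// hN0.
have [K [f [fsep fcov]]] := separated_net G b_r0.
have mG : measurable G.
  apply: measurableI; first exact: measurable_rect_oball.
  by apply: fin_bigcup_measurable => // alpha _; exact: measurable_rect.
have /choice[g gP] : forall j, exists ay : J * X, JN N ay.1 /\
    forall i, Rset ay.1 i (ay.2 i) /\ dist i (f j i) (ay.2 i) < b i.
  move=> j; have [_ [alpha Jalpha fD]] := fsep.1 j.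
  have /(_ _)/cid2 Y i : exists2 y, Rset alpha i y & dist i (f j i) y < b i.
    by apply/DeltaP; exact: fD.
  exists (alpha, fun i => s2val (Y i)); split=> // i; split=> /=.
    exact: (s2valP (Y i)).
  exact: (s2valP' (Y i)).
have fG j i : dist i (x i) (f j i) < r / 2 by exact: ((fsep.1 j).1 i).
(* The centre is the resonant point rather than [f j], as the scaling property requires. *)
pose Sc j i := oball (dist i) ((g j).2 i) (b i) `&` Delta (dist i) (Rset (g j).1 i) (e i).
have mSc j i : measurable (Sc j i) by exact: measurableI.
pose S j := rect (Sc j).
have mS j : measurable (S j) by exact: measurable_rect.
have pSc j i : 0 < p i (Sc j i).
  have [gR _] := (gP j).2 i; have /andP[_ bi] := b_r0 i.
  have /andP[lo _] := @scaling i (g j).1 _ _ _ gR (e_gt0 i) (eb i) bi.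
  by apply: lt_le_trans lo; rewrite !mulr_gt0 ?powR_gt0.
have PS j : 0 < P (S j) by rewrite (prod_content_rect mX_prod)//; exact: prodr_gt0.
pose PB := P (oball (distX dist) x r).
have PB_ge0 : 0 <= PB.
  by apply: (fin_content_ge0 Pfin); exact: (measurable_oball_distX dist_metric).
(* Each of the [K] pieces receives the same mass [PB / K]. *)
pose w j := PB / K%:R / P (S j).
have w_ge0 j : 0 <= w j by rewrite !divr_ge0// ltW.
pose nu A := \sum_j w j * P (A `&` S j).
pose SS := \bigcup_(j in [set: 'I_K]) S j.
pose pc := \prod_i c i; pose pC := \prod_i C i; pose pk := \prod_i k i.
pose B := \prod_i b i `^ delta i; pose p2 : R := \prod_(i < d) 2 `^ delta i.
pose p4 : R := \prod_(i < d) 4 `^ delta i; pose Rr := \prod_(i < d) (r / 2) `^ delta i.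
have [pc_gt0 pC_gt0 pk_gt0] : [/\ 0 < pc, 0 < pC & 0 < pk].
  by split; exact: prodr_gt0.
have [B_gt0 p2_gt0 p4_gt0 Rr_gt0] : [/\ 0 < B, 0 < p2, 0 < p4 & 0 < Rr].
  by split; apply: prod_pow_gt0 => // i; rewrite divr_gt0.
have PB_le : PB <= pC * (p2 * Rr).
  rewrite /PB oball_distX//.
  apply: le_trans (P_rect_le x (r := fun=> r) _) _.
    by move=> i; rewrite r_gt0 /=; lra.
  rewrite -(@prod_scale 2 (fun=> r / 2))//; last by move=> i; rewrite divr_gt0.
  by rewrite (_ : 2 * (r / 2) = r)//; field.
(* The doubled boxes around the net cover [G], whose mass ubiquity bounds below. *)
have K_ge : cu * (pc * Rr) <= K%:R * (pC * (p2 * B)).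
  apply: (@le_trans _ _ (P G)).
    apply: le_trans ubi; rewrite ler_pM2l//; apply: (P_rect_ge x (r := fun=> r / 2)).
    by move=> i; rewrite divr_gt0//=; lra.
  have -> : K%:R * (pC * (p2 * B)) = \sum_(j < K) pC * (p2 * B).
    by rewrite sumr_const card_ord mulr_natl.
  apply: le_trans (fin_content_bigU Pfin (s := index_enum 'I_K) (Q := predT)
    (F := fun j => rect (fun i => oball (dist i) (f j i) (2 * b i))) mG _ _) _.
  - by move=> j; exact: (@measurable_rect_oball (f j) (fun i => 2 * b i)).
  - move=> z /fcov [j hj]; exists j; split=> //; exact: mem_index_enum.
  apply: ler_sum => j _; rewrite /B -prod_scale//.
  apply: (P_rect_le (f j) (r := fun i => 2 * b i)) => i.
  by rewrite mulr_gt0//=; have := b_r8 i; lra.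
have K_gt0 : 0 < K%:R :> R.
  have l0 : 0 < cu * (pc * Rr) by rewrite !mulr_gt0.
  have r0' : 0 < pC * (p2 * B) by rewrite !mulr_gt0.
  by rewrite -(pmulr_lgt0 _ r0'); exact: lt_le_trans K_ge.
have [tau tau_gt0 tau_e] : exists2 tau, 0 < tau & forall i, tau <= Num.min (r / 8) (e i).
  by apply: bigmin_gt0 => i; rewrite lt_min r8_gt0 e_gt0.
pose tau' := Num.min tau (r / 8).
have tau'_gt0 : 0 < tau' by rewrite lt_min tau_gt0.
exists nu, SS, tau', (\sum_j w j); split.
- split=> //.
  + exact: (fin_content_combination w_ge0 (fun=> Pfin) mS).
  + by apply: fin_bigcup_measurable => //; exact: finite_finset.
  + exact: sumr_ge0.
- move=> y [j _ Sy] z yz.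
  have yzi i : dist i (y i) (z i) < tau' by exact: le_lt_trans (dist_le_distX _ _ _ _) yz.
  have [t8 te] : tau' <= r / 8 /\ forall i, tau' <= e i.
    rewrite /tau' ge_min lexx orbT; split=> // i.
    by rewrite ge_min (le_trans (tau_e i))// ge_min lexx orbT.
  split.
    exists N => //; exists (g j).1; first exact: (gP j).1.
    move=> i; have [_ /DeltaP [q Rq yq]] := Sy i.
    apply/DeltaP; exists q => //; apply: le_lt_trans (dtri _ (y i) _) _.
    (* Here the factor [2] of [good_scales] is spent: one [e i] leads from [y] to the resonant set,
       the other from [z] to [y]. *)
    apply: (@lt_le_trans _ _ (2 * e i)).
      by rewrite dsym; have := yzi i; have := te i; lra.
    rewrite /e powRD ?(gt_eqF hN0) ?implybT// mulrCA.
    by rewrite ler_pM2l ?powR_gt0.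
  rewrite oball_distX// => i; rewrite /oball /=.
  have [_ fg] := (gP j).2 i; have [gy _] := Sy i; move: gy; rewrite /oball /= => gy.
  apply: le_lt_trans (dtri _ (f j i) _) _.
  apply: le_lt_trans (lerD (lexx _) (dtri _ ((g j).2 i) _)) _.
  apply: le_lt_trans (lerD (lexx _) (lerD (lexx _) (dtri _ (y i) _))) _.
  by have := fG j i; have := yzi i; have := b_r8 i; lra.
- split.
    rewrite /nu big1// => j _; rewrite (_ : _ `&` _ = set0) ?fin_content0 ?mulr0//.
    by apply/seteqP; split=> // y [nS yS]; apply: nS; exists j.
  rewrite /nu; under eq_bigr => j _ do rewrite setTI divfK ?gt_eqF//.
  by rewrite sumr_const card_ord -[LHS]mulr_natr divfK// gt_eqF.
- move=> A mA; rewrite /nu mulr_suml; apply: ler_sum => j _.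
  by rewrite ler_wpM2l//; apply: (fin_content_le Pfin) => //; exact: measurableI.
move=> y ep ep0 epr.
pose A := ln ep / ln (h N).
have lnh : ln (h N) < 0 by rewrite ln_lt0// hN0.
have A_gt0 : 0 < A.
  by rewrite /A nmulr_lgt0 ?invr_lt0// ln_lt0// ep0 (lt_le_trans epr).
have hA : h N `^ A = ep.
  by rewrite /powR (gt_eqF hN0) /A divfK ?lt_eqF// lnK// posrE.
pose mu i := Num.max ep (b i).
have mu_gt0 i : 0 < mu i by rewrite lt_max ep0.
have mu_r i : mu i <= r.
  by rewrite ge_max (ltW epr) /=; have := b_r8 i; lra.
pose Mm := \prod_i mu i `^ delta i.
have Mm_gt0 : 0 < Mm by exact: prod_pow_gt0.
rewrite oball_distX//; set U := rect _.
pose hits := [pred j : 'I_K | `[< U `&` S j !=set0 >]].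
have -> : nu U = \sum_(j in hits) w j * P (U `&` S j).
  rewrite /nu [RHS]big_mkcond; apply: eq_bigr => j _; case: ifPn => // /asboolPn.
  by move=> /set0P/negP/negPn/eqP ->; rewrite fin_content0// mulr0.
(* A hit box is centred within [ep + 2 * b i] of [y] in coordinate [i], so it lies within
   [4 * mu i]. *)
have card_hits : #|hits|%:R * (pc * B) <= pC * (p4 * Mm).
  rewrite /Mm -prod_scale//.
  apply: (separated_count (y := y) fsep b_r0) => [i|j /asboolP [z [Uz Sz]] i].
    by rewrite mulr_gt0//=; have := mu_r i; lra.
  have [_ fg] := (gP j).2 i; have [gz _] := Sz i; have := Uz i.
  move: gz; rewrite /oball /= => gz yz.
  have h1 : ep <= mu i by rewrite le_max lexx.
  have h2 : b i <= mu i by rewrite le_max lexx orbT.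
  have := dtri (y i) (z i) (f j i); have := dtri (z i) ((g j).2 i) (f j i).
  by rewrite (dsym (z i) ((g j).2 i)) (dsym ((g j).2 i) (f j i)); lra.
have term j : j \in hits -> w j * P (U `&` S j) <= PB / K%:R * (pk * ep `^ s) / Mm.
  move=> _; rewrite ler_pdivlMr// mulrAC /w.
  have -> : PB / K%:R / P (S j) * Mm * P (U `&` S j) =
     PB / K%:R * ((Mm * P (U `&` S j)) / P (S j)) by field; rewrite !gt_eqF.
  rewrite ler_wpM2l ?divr_ge0//ler_pdivrMr//.
  have US : U `&` S j = rect (fun i => oball (dist i) (y i) ep `&` Sc j i).
    apply/seteqP; split=> z.
      by move=> [h1 h2] i; split; [exact: h1|exact: h2].
    by move=> h1; split=> i; have [] := h1 i.
  rewrite US !(prod_content_rect mX_prod)//; last by move=> i; exact: measurableI.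
  rewrite -big_split /=.
  apply: (@le_trans _ _ (\prod_i (k i *
      h N `^ (delta i * (A - (1 - kappa) * clamp (a i) (t i) A)) * p i (Sc j i)))).
    apply: ler_prod => i _; rewrite mulr_ge0 ?powR_ge0//=; last first.
      by apply: (fin_content_ge0 (coord_content_fin m i)); exact: measurableI.
    have [gR _] := (gP j).2 i; have /andP[_ bi] := b_r0 i.
    have := @coordinate_estimate R _ (T i) (dist i) (p i) (delta i) kappa (C i) (c2 i) (c3 i) r0
      (dist_metric i) (dist_borel i) (coord_content_fin m i) kappa01 (C_gt0 i)
      (c2_gt0 i) (c3_gt0 i) (@p_le i) _ (y i) ((g j).2 i) (h N) (a i) (t i) A
      (@scaling i (g j).1) gR.
    rewrite hA hN0 hN1; apply => //; lra.
  rewrite !big_split /= ler_wpM2r//; first by apply: prodr_ge0 => i _; exact: ltW.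
  rewrite ler_pM2l// -hA -powRrM.
  (* As [h N < 1], the lower bound [s * A] on the exponent becomes the upper bound [ep ^ s]. *)
  rewrite (_ : \prod_i _ = h N `^ exponent delta a kappa t A).
    by apply: ger_powR; [rewrite hN0 ltW|rewrite mulrC s_exponent].
  rewrite /exponent; apply: (big_ind2 (fun x y => x = h N `^ y)) => //.
    by rewrite powRr0.
  by move=> x1 x2 y1 y2 -> ->; rewrite powRD// (gt_eqF hN0) implybT.
apply: le_trans (ler_sum _ term) _; rewrite sumr_const -[leLHS]mulr_natl.
rewrite /local_cst -/pk -/pC -/pc -/p4 -/p2.
set E := ep `^ s; have E_gt0 : 0 < E by exact: powR_gt0.
set nH := #|hits|%:R in card_hits *.
have nH_le : nH <= pC * (p4 * Mm) / (pc * B) by rewrite ler_pdivlMr ?mulr_gt0.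
have PBK_le : PB / K%:R <= pC ^+ 2 * p2 ^+ 2 * B / (cu * pc).
  rewrite ler_pdivrMr//; apply: le_trans PB_le _.
  have -> : pC ^+ 2 * p2 ^+ 2 * B / (cu * pc) * K%:R =
     pC * p2 / (cu * pc) * (K%:R * (pC * (p2 * B))) by field; rewrite !gt_eqF.
  apply: (@le_trans _ _ (pC * p2 / (cu * pc) * (cu * (pc * Rr)))).
    by rewrite le_eqVlt; apply/orP; left; apply/eqP; field; rewrite !gt_eqF.
  by rewrite ler_pM2l// divr_gt0 ?mulr_gt0.
(* [Mm] cancels between the count and the single term, and [B] between the count and [PB / K], so
   nothing depends on [N], [x] or [r]. *)
apply: (@le_trans _ _ (pC * (p4 * Mm) / (pc * B) *
   (pC ^+ 2 * p2 ^+ 2 * B / (cu * pc) * (pk * E) / Mm))).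
  apply: ler_pM => //; first by rewrite !divr_ge0 ?mulr_ge0 ?invr_ge0 ?ler0n ?(ltW Mm_gt0) ?(ltW pk_gt0) ?(ltW E_gt0).
  rewrite ler_wpM2r ?invr_ge0 ?(ltW Mm_gt0)// ler_wpM2r// mulr_ge0 ?(ltW pk_gt0) ?(ltW E_gt0)//.
by rewrite le_eqVlt; apply/orP; left; apply/eqP; field; rewrite !gt_eqF.
Qed.

End LocalMeasure.

(** * Hausdorff dimension *)

Section HausdorffCover.
Context {R : realType} {X : pointedType}.
Variable D : X -> X -> R.
Hypothesis D_metric : is_metric D.

(** The extra [e] makes the radius positive and larger than the diameter, even for a point or the
    empty set. The diameter being at most [1], passing from [sigma] to [sigma'] does not increase
    its power. *)
Lemma oball_of_diam (U : set X) (sigma sigma' e : R) : 0 <= sigma -> sigma < sigma' ->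
  0 < e -> (diam D U <= 1%:E)%E ->
  exists zr : X * R, [/\ 0 < zr.2, U `<=` oball D zr.1 zr.2 &
    zr.2 `^ sigma' <= fine (hterm D sigma U) + e].
Proof.
move=> s0 ss e0 dU; have s'0 : 0 < sigma' by exact: le_lt_trans ss.
have key (q : R) : 0 <= q -> exists r, [/\ 0 < r, q < r & r `^ sigma' = q `^ sigma' + e].
  move=> q0; exists ((q `^ sigma' + e) `^ sigma'^-1).
  have pos : 0 < q `^ sigma' + e by rewrite ltr_wpDl ?powR_ge0.
  split; first exact: powR_gt0.
    rewrite -[q in ltLHS](powRr1 q0) -(mulfV (lt0r_neq0 s'0)) powRrM.
    by apply: gt0_ltr_powR; rewrite ?invr_gt0 ?nnegrE ?powR_ge0 ?ltrDl// ltW.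
  by rewrite -powRrM mulVf ?gt_eqF// powRr1 ?ltW.
rewrite /hterm /=; case: asboolP => [->|/eqP/set0P [z Uz]].
  have [r [r0 _ re]] := key 0 (lexx _); exists (point, r); split=> //=.
  by rewrite re powR0 ?gt_eqF.
have dist_diam y y' : U y -> U y' -> ((D y y')%:E <= diam D U)%E.
  by move=> Uy Uy'; apply: ereal_sup_ubound; exists (y, y').
have D0 : D z z = 0 by case: D_metric => _ h _ _; apply/h.
have d0 : (0 <= diam D U)%E by have := dist_diam _ _ Uz Uz; rewrite D0.
have dfin : diam D U \is a fin_num by rewrite ge0_fin_numE// (le_lt_trans dU)// ltry.
have [r [r0 qr re]] := key (fine (diam D U)) (fine_ge0 d0).
exists (z, r); split=> //=.
  move=> y Uy; rewrite /oball /=; apply: le_lt_trans qr.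
  by rewrite -lee_fin fineK//; exact: dist_diam.
rewrite re lerD2r.
have := fine_ge0 d0; rewrite le_eqVlt => /orP[/eqP <-|q0].
  by rewrite powR0 ?gt_eqF// powR_ge0.
apply: ger_powR; last exact: ltW.
by rewrite q0 /= -lee_fin fineK.
Qed.

Lemma sum_half_powers (n : nat) : \sum_(k < n) (2^-1 : R) ^+ k.+1 = 1 - 2^-1 ^+ n.
Proof.
elim: n => [|n IH]; first by rewrite big_ord0 expr0 subrr.
by rewrite big_ord_recr /= IH exprS; field.
Qed.

Lemma hausdorff_null_cover (W : set X) (sigma sigma' e0 : R) :
  0 <= sigma -> sigma < sigma' -> 0 < e0 -> hausdorff D sigma W = 0%E ->
  exists (z : nat -> X) (r : nat -> R), [/\ forall k, 0 < r k,
    forall n, \sum_(k < n) r k `^ sigma' <= e0 &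
    W `<=` \bigcup_k oball D (z k) (r k)].
Proof.
move=> s0 ss e00 HW.
have Hd : (hausdorff_delta D sigma 1 W < (e0 / 2)%:E)%E.
  apply: (@le_lt_trans _ _ 0%E); last by rewrite lte_fin divr_gt0.
  by rewrite -HW; apply: ereal_sup_ubound; exists 1 => //=.
have [_ [U [WU dU] <-] sumU] := ereal_inf_lt Hd.
have hge0 k : 0 <= fine (hterm D sigma (U k)).
  by rewrite /hterm /=; case: asboolP => // _; exact: powR_ge0.
(* Half of [e0] is kept for the cover itself, the other half is shared geometrically among the
   enlargements. *)
have e_gt0 k : 0 < e0 / 2 * (2^-1) ^+ k.+1 by rewrite mulr_gt0 ?divr_gt0 ?exprn_gt0 ?invr_gt0.
have /choice[zr zrP] := fun k => oball_of_diam s0 ss (e_gt0 k) (dU k).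
exists (fun k => (zr k).1), (fun k => (zr k).2); split.
- by move=> k; have [] := zrP k.
- move=> n.
  apply: (@le_trans _ _ (\sum_(k < n) (fine (hterm D sigma (U k)) + e0 / 2 * (2^-1) ^+ k.+1))).
    by apply: ler_sum => k _; have [] := zrP k.
  rewrite big_split /= -mulr_sumr sum_half_powers.
  have : \sum_(k < n) fine (hterm D sigma (U k)) <= e0 / 2.
    rewrite -lee_fin -sumEFin; apply: le_trans (ltW sumU).
    rewrite -(big_mkord xpredT (fun k => (fine (hterm D sigma (U k)))%:E)).
    rewrite (eq_bigr (fun k => hterm D sigma (U k)))//.
    by apply: nneseries_lim_ge => k _ _; rewrite lee_fin; exact: hge0.
  have : 0 <= e0 / 2 * 2^-1 ^+ n by rewrite mulr_ge0 ?exprn_ge0 ?invr_ge0 ?divr_ge0 ?ltW.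
  by lra.
- by move=> x /WU [k _ Ux]; exists k => //; have [_ + _] := zrP k; exact.
Qed.

End HausdorffCover.

(** * Lower bound for the dimension of the limsup set *)

Section LowerBound.
Context {R : realType} {d : nat} {dT : 'I_d -> measure_display}.
Context {T : forall i : 'I_d, measurableType (dT i)} {J : Type}.
Variables (dist : forall i : 'I_d, T i -> T i -> R).
Variables (m : forall i : 'I_d, probability (T i) R).
Variable mX : {measure set (Xsig T) -> \bar R}.
Variables (delta : 'I_d -> R) (beta : J -> R) (ell u : nat -> R) (rho : R -> R).
Variables (kappa : R) (Rset : J -> forall i : 'I_d, set (T i)).
Variables (a : 'I_d -> R) (psi : 'I_d -> R -> R).
Arguments dist : clear implicits.
Arguments m : clear implicits.
Arguments Rset : clear implicits.
Hypothesis d_ge1 : (1 <= d)%N.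
Hypothesis dist_metric : forall i, is_metric (dist i).
Hypothesis dist_locally_compact : forall i, dlocally_compact (dist i).
Hypothesis dist_borel : forall i, @measurable _ (T i) = <<s dopen (dist i) >>.
Hypothesis mX_prod : forall B : forall i, set (T i), (forall i, measurable (B i)) ->
  mX [set x : Xsig T | forall i, B i (x i)] = (\prod_(i < d) m i (B i))%E.
Hypothesis delta_gt0 : forall i, 0 < delta i.
Hypothesis ahlfors : forall i, exists c C r0 : R, [/\ 0 < c, 0 < C, 0 < r0 &
     forall x r, 0 < r -> r <= r0 ->
       ((c * r `^ delta i)%:E <= m i (oball (dist i) x r) <=
        (C * r `^ delta i)%:E)%E].
Hypothesis beta_gt0 : forall alpha, 0 < beta alpha.
Hypothesis beta_finite : forall M : R, 1 < M -> finite_set [set alpha | beta alpha < M].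
Hypothesis u_incr : {homo u : n k / (n < k)%N >-> n < k}.
Hypothesis ell_le_u : forall n, ell n <= u n.
Hypothesis ell_oo : ell @ \oo --> +oo.
Hypothesis rho_gt0 : forall x, 0 < x -> 0 < rho x.
Hypothesis rho_noninc : forall x y, 0 < x -> x <= y -> rho y <= rho x.
Hypothesis rho_cvg0 : rho x @[x --> +oo] --> (0 : R).
Hypothesis kappa01 : 0 <= kappa < 1.
Hypothesis scaling : forall i, exists c2 c3 r0 : R, [/\ 0 < c2, 0 < c3, 0 < r0 &
     forall alpha x eps r, Rset alpha i x -> 0 < eps -> eps < r -> r <= r0 ->
       ((c2 * r `^ (delta i * kappa) * eps `^ (delta i * (1 - kappa)))%:E
          <= m i (oball (dist i) x r `&` Delta (dist i) (Rset alpha i) eps)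
          <= (c3 * r `^ (delta i * kappa) * eps `^ (delta i * (1 - kappa)))%:E)%E].
Hypothesis a_gt0 : forall i, 0 < a i.
Hypothesis ubiquity : exists2 c : R, 0 < c & forall (x : Xsig T) (r : R), 0 < r ->
     exists n0 : nat, forall n, (n0 <= n)%N ->
       (c%:E * mX (ballX dist x r)
        <= mX (ballX dist x r `&`
               \bigcup_(alpha in [set alpha | (ell n <= beta alpha <= u n)%R])
                 DeltaX dist (Rset alpha) (fun i => (rho (u n) `^ a i)%R)))%E.
Hypothesis psi_gt0 : forall i x, 0 < x -> 0 < psi i x.
Hypothesis psi_decr : forall i x y, 0 < x -> x < y -> psi i y < psi i x.

Local Notation X := (Xsig T).
Local Notation p i := (@coord_content R d dT T m i).
Local Notation P := (prod_content mX).

Definition limsup_set : set X := [set x : X | infinite_set [set alpha |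
  DeltaX dist (Rset alpha) (fun i => rho (beta alpha) `^ a i * psi i (beta alpha)) x]].

Let JN n := [set alpha | ell n <= beta alpha <= u n].

Lemma ell_eventually (M : R) : exists n0, forall n, (n0 <= n)%N -> M < ell n.
Proof. by move/cvgryPgt: ell_oo => /(_ M) [n0 _ h]; exists n0. Qed.

Lemma JN_finite n : finite_set (JN n).
Proof.
have M1 : 1 < Num.max 1 (u n) + 1 by rewrite ltr_pwDr ?le_max ?lexx.
apply: sub_finite_set (beta_finite M1) => alpha /andP[_ h] /=.
by rewrite ltr_pwDr// le_max h orbT.
Qed.

Lemma rho_u_small (e : R) : 0 < e ->
  exists n0, forall n, (n0 <= n)%N -> 0 < u n /\ 0 < rho (u n) < e.
Proof.
move=> e0; move/cvgrPdist_lt: rho_cvg0 => /(_ e e0) [M [Mr hM]].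
have [n0 hn0] := ell_eventually (Num.max 0 M).
exists n0 => n nn; have := lt_le_trans (hn0 n nn) (ell_le_u n).
rewrite gt_max => /andP[u0 uM]; split=> //; rewrite rho_gt0//=.
have := hM _ uM; rewrite sub0r normrN; apply: le_lt_trans; exact: ler_norm.
Qed.

(** If only finitely many [alpha] occurred, their [beta alpha] would be bounded, whereas scale [N]
    provides one with [beta alpha >= ell N]. Since [beta alpha <= u N], the radii taken at [u N] are
    the smaller ones. *)
Lemma tail_union_limsup :
  \bigcap_n tail_union dist a Rset JN (fun n => rho (u n)) (fun n i => psi i (u n)) n
    `<=` limsup_set.
Proof.
move=> x hx; rewrite /limsup_set /= => fin.
have [M hM] : exists M, forall alpha,
    DeltaX dist (Rset alpha) (fun i => rho (beta alpha) `^ a i * psi i (beta alpha)) x ->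
    beta alpha <= M.
  have : finite_set (beta @` [set alpha | DeltaX dist (Rset alpha)
    (fun i => rho (beta alpha) `^ a i * psi i (beta alpha)) x]) by exact: finite_image.
  move=> /finite_seqP [l hl]; exists (\big[Num.max/0]_(z <- l) z) => alpha Ha.
  have bl : [set` l] (beta alpha) by rewrite -hl; exists alpha.
  exact: (le_bigmax_seq 0 (beta alpha) xpredT id bl isT).
have [n0 hn0] := ell_eventually M.
have [N n0N [alpha /andP[lb bu] Da]] := hx n0 I.
suff /hM : DeltaX dist (Rset alpha) (fun i => rho (beta alpha) `^ a i * psi i (beta alpha)) x.
  by have := hn0 N n0N; lra.
move=> i; have /DeltaP [e Re xe] := Da i; apply/DeltaP; exists e => //.
apply: lt_le_trans xe _; have b0 := beta_gt0 alpha.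
apply: ler_pM; rewrite ?powR_ge0//.
- by apply: ltW; apply: psi_gt0; exact: lt_le_trans bu.
- apply: ge0_ler_powR; rewrite ?nnegrE ?(ltW (a_gt0 i))// ?(ltW (rho_gt0 _))//.
    exact: lt_le_trans bu.
  exact: rho_noninc.
- move: bu; rewrite le_eqVlt => /orP[/eqP ->//|bu].
  by apply: ltW; exact: psi_decr.
Qed.

Lemma exponent_le_sum (t : 'I_d -> R) (s : R) : (forall i, 0 <= t i) ->
  (forall A, 0 < A -> s * A <= exponent delta a kappa t A) -> s <= \sum_i delta i.
Proof.
move=> t0 /(_ 1 ltr01); rewrite mulr1 => h; apply: le_trans h _.
apply: ler_sum => i _; apply: (ler_piMr (ltW (delta_gt0 i))); rewrite gerBl.
case/andP: kappa01 => k0 k1.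
by rewrite mulr_ge0 ?subr_ge0 ?(ltW k1)// /clamp le_min t0 le_max lexx orbT.
Qed.

Lemma dimnum_le_s_at (t : 'I_d -> R) (sigma : R) :
  (sigma%:E < dimnum delta a kappa t)%E ->
  exists2 s, sigma < s & forall i, s <= s_at delta a t kappa (a i) /\
    s <= s_at delta a t kappa (a i + t i).
Proof.
move=> sd.
pose F i := Num.min (s_at delta a t kappa (a i)) (s_at delta a t kappa (a i + t i)).
(* The default [sigma + 1] replaces [+oo]: it keeps the minimum real and above [sigma]. *)
exists (\big[Num.min/sigma + 1]_i F i); last first.
  move=> i; have : \big[Num.min/sigma + 1]_i F i <= F i by exact: bigmin_le.
  by rewrite le_min => /andP[].
apply: lt_bigmin => [|i _]; first by rewrite ltrDl.
have : (sigma%:E < Order.min (s_at delta a t kappa (a i))%:E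
   (s_at delta a t kappa (a i + t i))%:E)%E by apply: lt_le_trans sd _; exact: bigmin_le.
by rewrite lt_min !lte_fin -lt_min.
Qed.

Lemma common_radius : exists (c C c2 c3 : 'I_d -> R) (r0 : R),
  [/\ forall i, [/\ 0 < c i, 0 < C i, 0 < c2 i & 0 < c3 i], 0 < r0,
    forall i x r, 0 < r -> r <= r0 -> c i * r `^ delta i <= p i (oball (dist i) x r),
    forall i x r, 0 < r -> r <= r0 -> p i (oball (dist i) x r) <= C i * r `^ delta i &
    forall i alpha, kappa_scaling (dist i) (p i) (delta i) kappa (c2 i) (c3 i) r0 (Rset alpha i)].
Proof.
have /choice[A AP] : forall i, exists A : R * R * R, [/\ 0 < A.1.1, 0 < A.1.2, 0 < A.2 &
     forall x r, 0 < r -> r <= A.2 ->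
       ((A.1.1 * r `^ delta i)%:E <= m i (oball (dist i) x r) <=
        (A.1.2 * r `^ delta i)%:E)%E].
  by move=> i; have [c [C [r0 h]]] := ahlfors i; exists (c, C, r0).
have /choice[B BP] : forall i, exists A : R * R * R, [/\ 0 < A.1.1, 0 < A.1.2, 0 < A.2 &
     forall alpha x eps r, Rset alpha i x -> 0 < eps -> eps < r -> r <= A.2 ->
       ((A.1.1 * r `^ (delta i * kappa) * eps `^ (delta i * (1 - kappa)))%:E
          <= m i (oball (dist i) x r `&` Delta (dist i) (Rset alpha i) eps)
          <= (A.1.2 * r `^ (delta i * kappa) * eps `^ (delta i * (1 - kappa)))%:E)%E].
  by move=> i; have [c [C [r0 h]]] := scaling i; exists (c, C, r0).
have [r0 r00 r0i] : exists2 r0, 0 < r0 & forall i, r0 <= Num.min (A i).2 (B i).2.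
  by apply: bigmin_gt0 => i; rewrite lt_min; have [_ _ -> _] := AP i; have [_ _ -> _] := BP i.
exists (fun i => (A i).1.1), (fun i => (A i).1.2), (fun i => (B i).1.1), (fun i => (B i).1.2), r0.
have mb i x r : measurable (oball (dist i) x r) by exact: borel_oball.
split=> //.
- by move=> i; have [? ? _ _] := AP i; have [? ? _ _] := BP i.
- move=> i x r rp rr; have := r0i i; rewrite le_min => /andP[h1 _].
  have [_ _ _ /(_ x r rp (le_trans rr h1))] := AP i.
  by rewrite coord_contentE// !lee_fin => /andP[].
- move=> i x r rp rr; have := r0i i; rewrite le_min => /andP[h1 _].
  have [_ _ _ /(_ x r rp (le_trans rr h1))] := AP i.
  by rewrite coord_contentE// !lee_fin => /andP[].
- move=> i alpha x eps r Rx e0 er rr; have := r0i i; rewrite le_min => /andP[_ h1].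
  have [_ _ _ /(_ alpha x eps r Rx e0 er (le_trans rr h1))] := BP i.
  rewrite coord_contentE ?lee_fin//; apply: measurableI => //; exact: borel_Delta.
Qed.

Lemma prod_powR (r : R) : 0 < r -> \prod_i r `^ delta i = r `^ (\sum_i delta i).
Proof.
move=> r0; apply: esym; apply: (big_morph (fun x => r `^ x)); last exact: powRr0.
by move=> x y; rewrite powRD// (gt_eqF r0) implybT.
Qed.

Lemma locally_compact_point : exists (x : X) (R0 : R) (K : set X),
  [/\ 0 < R0, dcompact (distX dist : X -> X -> R) K & oball (distX dist) x R0 `<=` K].
Proof.
pose x : X := point.
have /(_ _)/cid KP i : exists K, dcompact (dist i) K /\
    exists2 r : R, 0 < r & oball (dist i) (x i) r `<=` K by exact: dist_locally_compact.
have /(_ _)/cid2 rP i := (projT2 (KP i)).2.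
have [R0 R00 R0i] := bigmin_gt0 (fun i => s2valP (rP i)).
exists x, R0, (rect (fun i => projT1 (KP i))); split=> //.
  by apply: dcompact_rect => // i; exact: (projT2 (KP i)).1.
rewrite oball_distX// => y hy i; apply: (s2valP' (rP i)).
exact: lt_le_trans (hy i) (R0i i).
Qed.

(** The condition on scales is the common form of both accumulation hypotheses. A vanishing
    [sigma]-measure with [sigma] below the dimensional number would give a cover that
    [cantor_avoids_cover] escapes. *)
Lemma dimnum_le_dimH (t : 'I_d -> R) : (forall i, 0 <= t i) ->
  (forall (eta : R) n0, 0 < eta -> exists2 N, (n0 <= N)%N &
    forall i, rho (u N) `^ (t i + eta) <= psi i (u N)) ->
  (dimnum delta a kappa t <= dimH (distX dist : X -> X -> R) limsup_set)%E.
Proof.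
move=> t0 scales; apply: le_ereal_inf_tmp => _ [sigma [sigma0 Hsigma] <-].
rewrite leNgt; apply/negP => /dimnum_le_s_at [s2 ss2 hs2].
have d0 : (0 < d)%N := d_ge1.
(* From [s2] to [s] the exponent pays for [eta], from [s] to [s1] for the Cantor construction, and
   from [s1] to [sigma] for turning the cover into balls. *)
pose s := (sigma + s2) / 2; pose s1 := (sigma + s) / 2.
have [ss1 s1s s_s2] : [/\ sigma < s1, s1 < s & s < s2] by rewrite /s1 /s; split; lra.
have growth := exponent_ge a_gt0 d0 t0
  (fun i => (hs2 i).1) (fun i => (hs2 i).2).
have s2Q := exponent_le_sum t0 growth.
have [eta eta0 heta] := exponent_perturb delta_gt0 a_gt0 kappa01 d0 t0 s_s2 growth.
have [c [C [c2 [c3 [r0 [pos r00 pge ple scal]]]]]] := common_radius.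
have [c_gt0 C_gt0 c2_gt0 c3_gt0] : [/\ forall i, 0 < c i, forall i, 0 < C i,
  forall i, 0 < c2 i & forall i, 0 < c3 i] by split=> i; have [] := pos i.
have [cu cu0 ubi] := ubiquity.
have ubi' (x : X) r : 0 < r -> exists n0 : nat, forall n, (n0 <= n)%N ->
  cu * P (rect (fun i => oball (dist i) (x i) r)) <=
  P (rect (fun i => oball (dist i) (x i) r) `&`
     \bigcup_(alpha in JN n) rect (fun i => Delta (dist i) (Rset alpha i) (rho (u n) `^ a i))).
  move=> rp; have [n0 hn0] := ubi x r rp; exists n0 => n /hn0.
  have m1 : measurable (rect (fun i => oball (dist i) (x i) r)).
    by apply: measurable_rect => i; exact: borel_oball.
  have m2 : measurable (\bigcup_(alpha in JN n) rect
      (fun i => Delta (dist i) (Rset alpha i) (rho (u n) `^ a i))).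
    apply: fin_bigcup_measurable; first exact: JN_finite.
    by move=> alpha _; apply: measurable_rect => i; exact: borel_Delta.
  rewrite (prod_contentE mX_prod m1) -EFinM.
  by rewrite (prod_contentE mX_prod (measurableI _ _ m1 m2)) lee_fin.
have good h0 n0 : 0 < h0 -> exists2 N, (n0 <= N)%N &
    0 < rho (u N) < h0 /\ forall i, 2 * rho (u N) `^ (t i + eta) <= psi i (u N).
  (* Only [eta / 2] is asked of [scales]; the other half yields the factor [2], as [rho ^ (eta / 2)]
     drops below one half. *)
  move=> h00; have e2 : 0 < eta / 2 by rewrite divr_gt0.
  have q0 : 0 < (2^-1 : R) `^ (eta / 2)^-1 by rewrite powR_gt0.
  have e3 : 0 < Num.min h0 ((2^-1 : R) `^ (eta / 2)^-1) by rewrite lt_min h00.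
  have [n1 hn1] := rho_u_small e3.
  have [N] := scales (eta / 2) (maxn n0 n1) e2.
  rewrite geq_max => /andP[n0N n1N] hN; exists N => //.
  have [_ /andP[r_gt0]] := hn1 N n1N; rewrite lt_min => /andP[-> rq].
  rewrite r_gt0; split=> // i; apply: le_trans (hN i).
  rewrite [t i + eta](_ : _ = eta / 2 + (t i + eta / 2)); last by field.
  have -> : rho (u N) `^ (eta / 2 + (t i + eta / 2)) =
      rho (u N) `^ (eta / 2) * rho (u N) `^ (t i + eta / 2).
    by rewrite [LHS]powRD// (gt_eqF r_gt0) implybT.
  rewrite mulrA ler_piMl ?powR_ge0//.
  have h2 : 0 < (2^-1 : R) by rewrite invr_gt0.
  have := powR_lt_of_lt r_gt0 h2 e2 rq; lra.
(* The first term of [CQ] serves radii up to [r0]; beyond, the second one makes the bound at least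
   [1], the total mass. *)
pose Q := \sum_i delta i; pose CQ := \prod_i C i + (r0 `^ Q)^-1.
have pC0 : 0 < \prod_i C i by apply: prodr_gt0.
have CQ0 : 0 < CQ by rewrite addr_gt0// invr_gt0 powR_gt0.
have Pge (x : X) r : 0 < r -> r <= r0 ->
    \prod_i c i * r `^ Q <= P (oball (distX dist) x r).
  move=> rp rr; rewrite oball_distX// -prod_powR//.
  apply: (P_rect_ge dist_metric dist_borel mX_prod c_gt0 pge x (r := fun=> r)) => i.
  by rewrite rp.
have Pfin := prod_content_fin mX_prod.
have mball := measurable_oball_distX dist_metric dist_borel.
have Ple (x : X) r : 0 < r -> P (oball (distX dist) x r) <= CQ * r `^ Q.
  move=> rp; rewrite /CQ mulrDl; have [rr|/ltW rr] := leP r r0.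
    apply: (@le_trans _ _ (\prod_i C i * r `^ Q)); last first.
      by rewrite lerDl mulr_ge0 ?invr_ge0 ?powR_ge0.
    rewrite oball_distX// -prod_powR//.
    apply: (P_rect_le dist_metric dist_borel mX_prod ple x (r := fun=> r)) => i.
    by rewrite rp.
  apply: (@le_trans _ _ ((r0 `^ Q)^-1 * r `^ Q)); last first.
    by rewrite lerDr mulr_ge0 ?powR_ge0 ?(ltW pC0).
  apply: (@le_trans _ _ 1).
    rewrite -(prod_content_setT mX_prod); apply: (fin_content_le Pfin) => //.
    exact: mball.
  rewrite mulrC ler_pdivlMr ?powR_gt0// mul1r.
  apply: ge0_ler_powR => //; rewrite ?nnegrE ?(ltW r00) ?(ltW rp)//.
  by apply: sumr_ge0 => i _; exact: ltW.
have [x0 [R0 [K [R00 cK KR]]]] := locally_compact_point.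
have t'0 i : 0 < t i + eta by rewrite ltr_wpDl.
have [|||e0 e00 avoid] := cantor_avoids_cover (distX_metric dist_metric) (fun x r => mball x r)
  Pfin (prodr_gt0 _ (fun i _ => c_gt0 i)) CQ0 r00 (_ : 0 < Num.min (r0 / 4) 1)
  (local_cst_gt0 delta kappa c_gt0 C_gt0 c2_gt0 c3_gt0 cu0) Pge Ple (_ : 0 <= s1) s1s (_ : s1 < Q)
  (local_measure_exists dist_metric dist_borel mX_prod a_gt0 t'0 c_gt0 C_gt0 c2_gt0 c3_gt0
    cu0 kappa01 pge ple scal JN_finite ubi' good heta) R00 cK KR.
- by rewrite lt_min (divr_gt0 r00 (ltr0n _ 4)) ltr01.
- lra.
- by rewrite /Q; lra.
have [z [r [r_gt0 sum_r cover]]] :=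
  hausdorff_null_cover (distX_metric dist_metric) sigma0 ss1 e00 Hsigma.
have [x [xF xN]] := avoid z r r_gt0 sum_r.
have [k _ xk] := cover x (tail_union_limsup (fun n _ => xF n)).
exact: xN xk.
Qed.

(** The ratio of logarithms is below [t i + eta], and [ln (rho (u N)) < 0] reverses the
    inequality. *)
Lemma accum_scales (t : 'I_d -> R) :
  accum_pts (fun n i => ln (psi i (u n)) / ln (rho (u n))) t ->
  forall (eta : R) n0, 0 < eta -> exists2 N, (n0 <= N)%N &
    forall i, rho (u N) `^ (t i + eta) <= psi i (u N).
Proof.
move=> ht eta n0 eta0; have [n1 hn1] := rho_u_small ltr01.
have [N] := ht eta eta0 (maxn n0 n1); rewrite geq_max => /andP[n0N n1N] hN.
exists N => // i; have [u0 /andP[r0 r1]] := hn1 N n1N.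
have lnr : ln (rho (u N)) < 0 by rewrite ln_lt0// r0.
have := le_lt_trans (ler_norm _) (hN i).
rewrite ltrBlDl ltr_ndivrMr// => h.
rewrite -ler_ln ?posrE ?powR_gt0 ?psi_gt0// ln_powR; exact: ltW.
Qed.

Lemma accum_scales_nat (t : 'I_d -> R) :
  (fun n => ln (rho (u n.+1)) / ln (rho (u n))) @ \oo --> (1 : R) ->
  (forall i, 0 <= t i) ->
  accum_pts (fun n i => ln (psi i n%:R) / ln (rho n%:R)) t ->
  forall (eta : R) n0, 0 < eta -> exists2 N, (n0 <= N)%N &
    forall i, rho (u N) `^ (t i + eta) <= psi i (u N).
Proof.
move=> ratio t0 ht eta n0 eta0.
have e2 : 0 < eta / 2 by rewrite divr_gt0.
have te i : 0 < t i + eta / 2 by rewrite ltr_wpDl.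
(* [zeta] is the ratio error allowed by [(t i + eta / 2) * (1 + zeta) <= t i + eta]. *)
have [zeta zeta0 hzeta] : exists2 z, 0 < z & forall i, z <= eta / 2 / (t i + eta / 2).
  by apply: bigmin_gt0 => i; rewrite divr_gt0.
have [n1 hn1] := rho_u_small ltr01.
move/cvgrPdist_lt: ratio => /(_ zeta zeta0) [n2 _ hn2].
pose k0 := maxn n0 (maxn n1 n2).
have u_mono : {homo u : n k / (n <= k)%N >-> n <= k}.
  by move=> n k; rewrite leq_eqVlt => /orP[/eqP ->//|/u_incr/ltW].
(* This threshold forces [u k0 <= n], so the largest [k] with [u k <= n] is at least [k0]; it exists
   because [u] dominates [ell], which tends to infinity. *)
have [n] := ht (eta / 2) e2 (Num.trunc (u k0)).+1.
move=> nk hn.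
have unk : u k0 <= n%:R.
  by apply/ltW; apply: lt_le_trans (truncnS_gt _) _; rewrite ler_nat.
have [b hb] := ell_eventually n%:R.
have bnd k : u k <= n%:R -> (k <= b)%N.
  move=> uk; rewrite leqNgt; apply/negP => /ltnW /hb.
  by have := ell_le_u k; lra.
case: (ex_maxnP (ex_intro (fun k => u k <= n%:R) k0 unk) bnd) => k uk maxk.
have k0k := maxk k0 unk.
have : (k0 <= k)%N := k0k; rewrite !geq_max => /and3P[n0k n1k n2k].
have nk1 : n%:R < u k.+1.
  by rewrite ltNge; apply/negP => /maxk; rewrite ltnn.
exists k => // i.
have [uk0 /andP[rk0 rk1]] := hn1 k n1k.
have [uk1 /andP[rk10 rk11]] := hn1 k.+1 (leqW n1k).
have n_gt0 : 0 < n%:R :> R := lt_le_trans uk0 uk.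
have rn0 : 0 < rho n%:R by exact: rho_gt0.
have lk : ln (rho (u k)) < 0 by rewrite ln_lt0// rk0.
have rnk : rho n%:R <= rho (u k) by exact: rho_noninc.
have ln_n : ln (rho n%:R) < 0 by rewrite ln_lt0// rn0 (le_lt_trans rnk).
have ln_k1 : ln (rho (u k.+1)) <= ln (rho n%:R).
  by rewrite ler_ln ?posrE//; apply: rho_noninc => //; exact: ltW.
have psi_nk : psi i n%:R <= psi i (u k).
  by move: uk; rewrite le_eqVlt => /orP[/eqP ->//|uk]; apply: ltW; exact: psi_decr.
have h1 : (t i + eta / 2) * ln (rho n%:R) <= ln (psi i n%:R).
  have := le_lt_trans (ler_norm _) (hn i).
  by rewrite ltrBlDl ltr_ndivrMr// => /ltW.
have h2 : (1 + zeta) * ln (rho (u k)) <= ln (rho (u k.+1)).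
  have := hn2 k n2k; rewrite /= distrC => /(le_lt_trans (ler_norm _)).
  by rewrite ltrBlDl ltr_ndivrMr// => /ltW.
have h3 : (t i + eta / 2) * (1 + zeta) <= t i + eta.
  have := hzeta i; rewrite ler_pdivlMr// => h; lra.
rewrite -ler_ln ?posrE ?powR_gt0 ?psi_gt0// ln_powR.
apply: (@le_trans _ _ (ln (psi i n%:R))); last by rewrite ler_ln ?posrE ?psi_gt0.
apply: le_trans h1.
apply: (@le_trans _ _ ((t i + eta / 2) * ((1 + zeta) * ln (rho (u k))))).
  by rewrite mulrA ler_nM2r.
by rewrite ler_pM2l// (le_trans h2).
Qed.

End LowerBound.

Unset Implicit Arguments.

Theorem mainTheorem3 (R : realType) (d : nat) (dT : 'I_d -> measure_display)
  (T : forall i : 'I_d, measurableType (dT i))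
  (dist : forall i : 'I_d, T i -> T i -> R)
  (m : forall i : 'I_d, probability (T i) R)
  (mX : {measure set (Xsig T) -> \bar R})
  (delta : 'I_d -> R)
  (J : countType) (beta : J -> R) (ell u : nat -> R) (rho : R -> R)
  (kappa : R) (Rset : J -> forall i : 'I_d, set (T i))
  (a : 'I_d -> R) (psi : 'I_d -> R -> R) :
  (1 <= d)%N ->
  (* the metric spaces X_i: bounded, locally compact, with Borel sigma-algebra *)
  (forall i, is_metric (dist i)) ->
  (forall i, dbounded (dist i)) ->
  (forall i, dlocally_compact (dist i)) ->
  (forall i, @measurable _ (T i) = <<s dopen (dist i) >>) ->
  (* m = prod_i m_i on the product sigma-algebra *)
  (forall B : forall i, set (T i), (forall i, measurable (B i)) ->
     mX [set x : Xsig T | forall i, B i (x i)] = (\prod_(i < d) m i (B i))%E) ->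
  (* Ahlfors regularity *)
  (forall i, 0 < delta i) ->
  (forall i, exists c C r0 : R, [/\ 0 < c, 0 < C, 0 < r0 &
     forall x r, 0 < r -> r <= r0 ->
       ((c * r `^ delta i)%:E <= m i (oball (dist i) x r) <=
        (C * r `^ delta i)%:E)%E]) ->
  (* J infinite, beta *)
  infinite_set [set: J] ->
  (forall alpha, 0 < beta alpha) ->
  (forall M : R, 1 < M -> finite_set [set alpha | beta alpha < M]) ->
  (* ell_n, u_n *)
  {homo ell : n k / (n < k)%N >-> n < k} ->
  {homo u : n k / (n < k)%N >-> n < k} ->
  (forall n, ell n <= u n) ->
  ell @ \oo --> +oo ->
  (* rho *)
  (forall x, 0 < x -> 0 < rho x) ->
  (forall x y, 0 < x -> x <= y -> rho y <= rho x) ->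
  rho x @[x --> +oo] --> (0 : R) ->
  (* kappa-scaling property *)
  0 <= kappa < 1 ->
  (forall i, exists c2 c3 r0 : R, [/\ 0 < c2, 0 < c3, 0 < r0 &
     forall alpha x eps r, Rset alpha i x -> 0 < eps -> eps < r -> r <= r0 ->
       ((c2 * r `^ (delta i * kappa) * eps `^ (delta i * (1 - kappa)))%:E
          <= m i (oball (dist i) x r `&` Delta (dist i) (Rset alpha i) eps)
          <= (c3 * r `^ (delta i * kappa) * eps `^ (delta i * (1 - kappa)))%:E)%E]) ->
  (* uniform local ubiquity system for rectangles w.r.t. (rho, a) *)
  (forall i, 0 < a i) ->
  (exists2 c : R, 0 < c & forall (x : Xsig T) (r : R), 0 < r ->
     exists n0 : nat, forall n, (n0 <= n)%N ->
       (c%:E * mX (ballX dist x r)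
        <= mX (ballX dist x r `&`
               \bigcup_(alpha in [set alpha | (ell n <= beta alpha <= u n)%R])
                 DeltaX dist (Rset alpha) (fun i => (rho (u n) `^ a i)%R)))%E) ->
  (* Psi *)
  (forall i x, 0 < x -> 0 < psi i x) ->
  (forall i x y, 0 < x -> x < y -> psi i y < psi i x) ->
  let W := [set x : Xsig T | infinite_set [set alpha |
              DeltaX dist (Rset alpha)
                (fun i => rho (beta alpha) `^ a i * psi i (beta alpha)) x]] in
  let Uhat := accum_pts (fun n i => ln (psi i (u n)) / ln (rho (u n))) in
  let U := accum_pts (fun n i => ln (psi i n%:R) / ln (rho n%:R)) in
  ((forall t, Uhat t -> forall i, 0 <= t i) ->
     (ereal_sup [set dimnum delta a kappa t | t in Uhat]
        <= dimH (distX dist) W)%E)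
  /\
  ((fun n => ln (rho (u n.+1)) / ln (rho (u n))) @ \oo --> (1 : R) ->
   (forall t, U t -> forall i, 0 <= t i) ->
     (ereal_sup [set dimnum delta a kappa t | t in U]
        <= dimH (distX dist) W)%E).
Proof.
move=> d1 metr _ lc bor prod delta0 ahl _ beta0 betaf ellm um ellu elloo rho0 rhom rhoc kap
  scal a0 ubi psi0 psid W Uhat U; split=> [Uhat0|ratio U0].
- apply: ge_ereal_sup => _ [t Ut <-].
  apply: (dimnum_le_dimH d1 metr lc bor prod delta0 ahl beta0 betaf ellu elloo
    rho0 rhom rhoc kap scal a0 ubi psi0 psid) => [|eta n0]; first exact: Uhat0.
  exact: (accum_scales ellu elloo rho0 rhoc psi0 Ut).
- apply: ge_ereal_sup => _ [t Ut <-].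
  apply: (dimnum_le_dimH d1 metr lc bor prod delta0 ahl beta0 betaf ellu elloo
    rho0 rhom rhoc kap scal a0 ubi psi0 psid) => [|eta n0]; first exact: U0.
  exact: (accum_scales_nat um ellu elloo rho0 rhom rhoc psi0 psid ratio (U0 t Ut) Ut).
Qed.
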